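(* Let $n\ge d\ge 1$ and let $\xi_1,\dots,\xi_n$ be (possibly dependent) random vectors in $\mathbb{R}^d$ with partial sums $S_0=0$, $S_i=\xi_1+\dots+\xi_i$ for $1\le i\le n$, such that: ($\pm$Ex) for every permutation $\sigma$ of $\{1,\dots,n\}$ and all signs $\varepsilon_1,\dots,\varepsilon_n\in\{-1,+1\}$, the tuples $(\xi_1,\dots,\xi_n)$ and $(\varepsilon_1\xi_{\sigma(1)},\dots,\varepsilon_n\xi_{\sigma(n)})$ have the same distribution; (GP) for every $1\le j_1<\dots<j_d\le n$, the probability that the vectors $S_{j_1},\dots,S_{j_d}$ are linearly dependent is $0$. Let $C_n=\mathrm{Conv}(S_0,\dots,S_n)$. Fix $0\le k\le d-1$ and let $0\le i_1<\dots<i_{k+1}\le n$ be any indices. Then $$\mathbb{P}[\mathrm{Conv}(S_{i_1},\dots,S_{i_{k+1}})\in\mathcal{F}_k(C_n)]=\frac{2\left(P^{(n)}_{i_1,\dots,i_{k+1}}(d-k-1)+P^{(n)}_{i_1,\dots,i_{k+1}}(d-k-3)+\dots\right)}{2^{i_1+n-i_{k+1}}\,i_1!\,(i_2-i_1)!\cdots(i_{k+1}-i_k)!\,(n-i_{k+1})!},$$ where the numbers $P^{(n)}_{i_1,\dots,i_{k+1}}(j)$ are the coefficients of the polynomial $$(t+1)(t+3)\cdots(t+2i_1-1)\times(t+1)(t+3)\cdots(t+2(n-i_{k+1})-1)\times\prod_{l=1}^{k}\big((t+1)(t+2)\cdots(t+i_{l+1}-i_l-1)\big)=\sum_{j=0}^{n-k}P^{(n)}_{i_1,\dots,i_{k+1}}(j)\,t^j,$$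 and $P^{(n)}_{i_1,\dots,i_{k+1}}(j):=0$ for $j<0$ or $j>n-k$.
   Context: $\mathrm{Conv}$ denotes the convex hull and $\mathcal{F}_k(C)$ is the set of all $k$-dimensional faces of a convex polytope $C$. Empty products (e.g. the first factor when $i_1=0$, the second when $i_{k+1}=n$, or a factor with $i_{l+1}-i_l=1$) equal $1$. *)

(* Defs.v *)
From HB Require Import structures.
From mathcomp Require Import all_boot all_order all_fingroup all_algebra.
From mathcomp Require Import all_classical all_reals all_analysis.

Set Implicit Arguments.
Unset Strict Implicit.
Unset Printing Implicit Defensive.

Import Order.TTheory GRing.Theory Num.Theory.
Import numFieldNormedType.Exports.

Local Open Scope classical_set_scope.
Local Open Scope ring_scope.

(* Matrices carry the sigma-algebra generated by their entries, as the library
   does for tuples; over a realType this is the Borel sigma-algebra. *)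
Definition measure_matrix_display : measure_display -> measure_display.
Proof. exact. Qed.

Section measurable_matrix.
Context {d : measure_display} {T : measurableType d}.
Variables m n : nat.

Definition matrix_cylinder : set_system 'M[T]_(m, n) :=
  [set A | exists (i : 'I_m) (j : 'I_n) (B : set T),
     measurable B /\ A = [set M : 'M[T]_(m, n) | B (M i j)]].

Let matrix_set0 : <<s matrix_cylinder >> set0.
Proof. exact: sigma_algebra0. Qed.

Let matrix_setC A : <<s matrix_cylinder >> A -> <<s matrix_cylinder >> (~` A).
Proof. exact: sigma_algebraC. Qed.

Let matrix_bigcup (F : (set 'M[T]_(m, n))^nat) :
  (forall i, <<s matrix_cylinder >> (F i)) ->
  <<s matrix_cylinder >> (\bigcup_i (F i)).
Proof. exact: sigma_algebra_bigcup. Qed.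

HB.instance Definition _ := @isMeasurable.Build (measure_matrix_display d)
  'M[T]_(m, n) <<s matrix_cylinder >> matrix_set0 matrix_setC matrix_bigcup.

End measurable_matrix.

Section polytope.
Context {R : realType} {V : vectType R}.
Implicit Types A C F : set V.

Definition convex_hull A : set V := smallest (@convex_set R V) A.

Definition affine_hull A : set V :=
  [set x | exists m (a : 'I_m -> V) (c : 'I_m -> R),
     [/\ forall r, A (a r), \sum_(r < m) c r = 1
       & x = \sum_(r < m) c r *: a r]].

(* No set of dimension k is empty. *)
Definition has_dim (k : nat) A : Prop :=
  exists (x : V) (U : {vspace V}),
    \dim U = k /\ affine_hull A = [set x + u | u in [set` U]].

(* Taking f = 0 makes C a face of itself. *)
Definition is_face C F : Prop :=
  exists (f : {linear V -> R^o}) (c : R),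
    (forall x, C x -> f x <= c) /\ F = C `&` [set x | f x = c].

Definition faces (k : nat) C : set (set V) :=
  [set F | is_face C F /\ has_dim k F].

End polytope.

Section random_walk.
Context {dT : measure_display} {T : measurableType dT} {R : realType}.
Context {P : probability T R} {n d : nat}.
Variable xi : 'I_n -> {RV P >-> 'rV[R]_d}.

(* The steps are numbered from 0, so partial_sum i adds up xi 0, ..., xi i.-1. *)
Definition partial_sum (i : nat) (w : T) : 'rV[R]_d :=
  \sum_(j < n | (j < i)%N) xi j w.

(* The tuple of steps is encoded as the n x d matrix whose rows are the steps. *)
Definition signed_exchangeable : Prop :=
  forall (s : 'S_n) (e : 'I_n -> bool) (B : set 'M[R]_(n, d)),
    measurable B ->
    P [set w | B (\matrix_(j < n) xi j w)] =
    P [set w | B (\matrix_(j < n) ((-1) ^+ e j *: xi (s j) w))].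

Definition general_position : Prop :=
  forall j : 'I_d -> nat,
    (forall a : 'I_d, (1 <= j a <= n)%N) ->
    (forall a b : 'I_d, (a < b)%N -> (j a < j b)%N) ->
    P [set w | ~~ free [seq partial_sum (j a) w | a : 'I_d]] = 0%E.

Definition walk_hull (w : T) : set 'rV[R]_d :=
  convex_hull [set partial_sum i w | i in [set i | (i <= n)%N]].

End random_walk.

Section face_polynomial.
Context {R : realType}.
Variables (n k : nat) (i : 'I_k.+1 -> nat).

Definition gap (l : 'I_k) : nat :=
  (i (lift ord0 l) - i (widen_ord (leqnSn k) l))%N.

Definition face_poly : {poly R} :=
  (\prod_(0 <= m < i ord0) ('X + (2 * m + 1)%N%:R)) *
  (\prod_(0 <= m < n - i ord_max) ('X + (2 * m + 1)%N%:R)) *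
  \prod_(l < k) \prod_(1 <= m < gap l) ('X + m%:R).

Definition face_coef (j : int) : R :=
  match j with Posz m => face_poly`_m | Negz _ => 0 end.

End face_polynomial.

(* Main.v *)
Require Import Defs.
From HB Require Import structures.
From mathcomp Require Import all_boot all_order all_fingroup all_algebra.
From mathcomp Require Import all_classical all_reals all_analysis.
From mathcomp Require Import measurable_realfun zify ring lra.

(* By (+-Ex) the law of the steps is invariant under the group G of signed
   permutations which permute the steps inside each of the blocks cut out by
   the indices [i 0 < ... < i k] and change signs only in the first and in the
   last block, so the probability is the average over [h] in G of the indicator
   of the event that the walk with steps [h x] has the given face.  Almost
   surely the steps are in general position, and then this number of [h] is
   deterministic.

   A functional is maximal on the walk exactly at the given vertices iff its
   values on the steps pair positively with a polyhedral cone, the base chamber;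
   by Gordan's alternative the face is missing iff a chamber [h^-1 * base] meets
   the space of linear relations between the steps.  The chambers of G are the
   regions of the arrangement of hyperplanes z_a = +- z_b (same block) and
   z_a = 0 (first and last block), which is supersolvable: deletion-restriction,
   adding the hyperplanes coordinate by coordinate, counts the regions of a
   generic section of it, and the resulting recursion is solved by alternating
   sums of coefficients of the product of the ('X + size of the level). *)

Set Implicit Arguments.
Unset Strict Implicit.
Unset Printing Implicit Defensive.

Import Order.TTheory GRing.Theory Num.Theory.
Import numFieldNormedType.Exports.

Local Open Scope classical_set_scope.
Local Open Scope ring_scope.

(** * Regions of hyperplane arrangements *)

(** The shape of G comes from summation by parts: for a functional f with maximum c on the walk and
    a relation y between the steps, the weights c - f(S_p) >= 0 pair with the increments of y padded
    by 0 at both ends. Positive increments off the vertices mean that y increases along every block,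
    is positive on the first and negative on the last: a chamber for permutations of the inner
    blocks and signed permutations of the two outer ones. Two obstacles remain. The flats of the
    arrangement involve signed sums over arbitrary disjoint sets of steps, whereas (GP) speaks of
    partial sums in the given order; exchangeability is therefore used a second time, to extend (GP)
    to all signed rearrangements. And exchangeability applies to measurable sets of matrices,
    whereas being a face quantifies over uncountably many functionals; Fourier-Motzkin elimination
    removes this quantifier. The faces are counted by complement in G, whose order is the product of
    the 1 + x over the level sizes x. In dimension 0 the region count is the product of the 1 - x,
    so one polynomial is compared, up to sign, at 1 and -1: hence the factor 2 and the indices
    falling by two. *)

Section regions.
Context {R : realFieldType} {U : lmodType R} {F : eqType}.
Variable ev : F -> U -> R.
Hypothesis evL : forall phi a u v, ev phi (a *: u + v) = a * ev phi u + ev phi v.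
Implicit Types (Q M : set U) (s l : seq F) (phi psi : F).

(* The number of vectors of (nonzero) signs of the forms in [s] realized on [Q]. *)
Fixpoint regions s Q : nat :=
  if s is phi :: s' then
    addn (regions s' (Q `&` [set z | 0 < ev phi z]))
         (regions s' (Q `&` [set z | ev phi z < 0]))
  else `[<Q !=set0>].

Definition subspace M := M 0 /\ forall a u v, M u -> M v -> M (a *: u + v).

(** Openness relative to [M] is tested along rays, which keeps the argument algebraic over any
    ordered field. *)
Definition open_convex_in M Q :=
  [/\ forall x y t, Q x -> Q y -> 0 <= t <= 1 -> Q (t *: x + (1 - t) *: y),
      forall x v, Q x -> M v ->
        exists2 e, 0 < e & forall t, 0 <= t <= e -> Q (t *: v + x) &
      Q `<=` M].

Lemma ev0 phi : ev phi 0 = 0.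
Proof. by have := evL phi 1 0 0; rewrite scaler0 addr0 mul1r; lra. Qed.

Lemma evZ phi a u : ev phi (a *: u) = a * ev phi u.
Proof. by rewrite -[a *: u]addr0 evL ev0 addr0. Qed.

Lemma open_convex_self M : subspace M -> open_convex_in M M.
Proof.
move=> [M0 ML]; split => // [x y t Mx My _|x v Mx Mv].
  by apply: (ML) => //; rewrite -[_ *: y]addr0; apply: ML.
by exists 1 => // t _; apply: ML.
Qed.

Lemma open_convex_pos M Q phi : open_convex_in M Q ->
  open_convex_in M (Q `&` [set z | 0 < ev phi z]).
Proof.
move=> [Qc Qo QM]; split=> [x y t [Qx x0] [Qy y0] t01|x v [Qx x0] Mv|x [/QM]//].
  split; first exact: Qc.
  rewrite /= evL evZ; move: x0 y0 => /= x0 y0; nra.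
have [e e0 He] := Qo x v Qx Mv; move: x0 => /= x0.
have ev1 : 0 < 1 + `|ev phi v| by have := normr_ge0 (ev phi v); lra.
(* This radius keeps the value at least [ev phi x / 2]; the added 1 covers [ev phi v = 0]. *)
exists (Num.min e (ev phi x / (1 + `|ev phi v|) / 2)).
  by rewrite lt_min e0 /= !divr_gt0.
move=> t /andP[t0]; rewrite le_min => /andP[te tx]; split => /=.
  by apply: He; rewrite t0.
rewrite evL.
have h : t * (1 + `|ev phi v|) <= ev phi x / 2.
  by rewrite -ler_pdivlMr// mulrAC.
have : - `|ev phi v| <= ev phi v by rewrite lerNl -normrN ler_norm.
nra.
Qed.

Lemma open_convex_neg M Q phi : open_convex_in M Q ->
  open_convex_in M (Q `&` [set z | ev phi z < 0]).
Proof.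
move=> [Qc Qo QM]; split=> [x y t [Qx x0] [Qy y0] t01|x v [Qx x0] Mv|x [/QM]//].
  split; first exact: Qc.
  rewrite /= evL evZ; move: x0 y0 => /= x0 y0; nra.
have [e e0 He] := Qo x v Qx Mv; move: x0 => /= x0.
have ev1 : 0 < 1 + `|ev phi v| by have := normr_ge0 (ev phi v); lra.
exists (Num.min e (- ev phi x / (1 + `|ev phi v|) / 2)).
  by rewrite lt_min e0 /= !divr_gt0// oppr_gt0.
move=> t /andP[t0]; rewrite le_min => /andP[te tx]; split => /=.
  by apply: He; rewrite t0.
rewrite evL.
have h : t * (1 + `|ev phi v|) <= - ev phi x / 2.
  by rewrite -ler_pdivlMr// mulrAC.
have : ev phi v <= `|ev phi v| by rewrite ler_norm.
nra.
Qed.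

Lemma regions_empty s Q : Q = set0 -> regions s Q = 0%N.
Proof.
elim: s Q => [|phi s IHs] Q -> /=.
  by rewrite asboolF// => -[].
by rewrite !set0I !IHs.
Qed.

(** Deletion-restriction. Splitting by all forms of [s] first leaves a single open convex cell. Such
    a cell is cut in two by [psi] exactly when it meets [psi = 0]: convexity gives a zero between
    two signs, openness pushes a zero to both sides. *)
Lemma regions_restriction M Q psi s : subspace M -> open_convex_in M Q ->
  (exists2 v, M v & ev psi v != 0) ->
  regions (psi :: s) Q =
  addn (regions s Q) (regions s (Q `&` [set z | ev psi z = 0])).
Proof.
move=> sM; elim: s Q => [|phi s IHs] Q ocQ [v Mv v0] /=; last first.
  have exv : exists2 v, M v & ev psi v != 0 by exists v.
  have /= E1 := IHs (Q `&` _) (open_convex_pos phi ocQ) exv.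
  have /= E2 := IHs (Q `&` _) (open_convex_neg phi ocQ) exv.
  rewrite [RHS]addnACA ![(_ `&` [set z | ev psi z = 0] `&` _)]setIAC.
  by rewrite -E1 -E2 addnACA ![(_ `&` [set z | 0 < ev psi z] `&` _)]setIAC
    ![(_ `&` [set z | ev psi z < 0] `&` _)]setIAC.
have [Qc Qo QM] := ocQ; have [M0 ML] := sM.
have pert x : Q x -> ev psi x = 0 ->
    (Q `&` [set z | 0 < ev psi z]) !=set0 /\
    (Q `&` [set z | ev psi z < 0]) !=set0.
  move=> Qx x0; have [e e0 He] := Qo x v Qx Mv.
  have [e' e0' He'] := Qo x ((-1) *: v) Qx ltac:(by rewrite -[_ *: v]addr0; apply: ML).
  have h1 := He e; have h2 := He' e'.
  rewrite lexx ltW// in h1; rewrite lexx ltW// in h2.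
  have := evL psi e v x; have := evL psi e' ((-1) *: v) x.
  rewrite x0 evZ !addr0 => E2 E1.
  have [vp|vn|/eqP] := ltrgt0P (ev psi v); last by rewrite (negbTE v0).
    split; first by exists (e *: v + x); split; [exact: h1|rewrite /= E1 mulr_gt0].
    exists (e' *: ((-1) *: v) + x); split; [exact: h2|rewrite /= E2; nra].
  split; last by exists (e *: v + x); split; [exact: h1|rewrite /= E1; nra].
  by exists (e' *: ((-1) *: v) + x); split; [exact: h2|rewrite /= E2; nra].
have ivt x y : Q x -> 0 < ev psi x -> Q y -> ev psi y < 0 ->
    (Q `&` [set z | ev psi z = 0]) !=set0.
  move=> Qx x0 Qy y0; have xy : 0 < ev psi x - ev psi y by lra.
  pose t := - ev psi y / (ev psi x - ev psi y).
  exists (t *: x + (1 - t) *: y); split; last first.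
    by rewrite /= evL evZ /t; field; lra.
  apply: Qc => //; rewrite /t divr_ge0 ?ler_pdivrMr//=; lra.
case: (asboolP ((Q `&` [set z | 0 < ev psi z]) !=set0)) => [[x [Qx x0]]|np];
case: (asboolP ((Q `&` [set z | ev psi z < 0]) !=set0)) => [[y [Qy y0]]|nn] /=.
- by rewrite !asboolT//; [exact: ivt Qx x0 Qy y0|exists x].
- rewrite asboolT; last by exists x.
  by rewrite asboolF// => -[w [Qw w0]]; apply: nn; have [] := pert w Qw w0.
- rewrite asboolT; last by exists y.
  by rewrite asboolF// => -[w [Qw w0]]; apply: np; have [] := pert w Qw w0.
- rewrite !asboolF//.
    by move=> [w [Qw w0]]; apply: np; have [] := pert w Qw w0.
  move=> [w Qw]; have [wp|wn|w0] := ltrgt0P (ev psi w).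
  - by apply: np; exists w.
  - by apply: nn; exists w.
  - by apply: np; have [] := pert w Qw w0.
Qed.

Lemma regions_proportional Q psi phi c s : phi \in s -> c != 0 ->
  (forall z, Q z -> ev psi z = c * ev phi z) ->
  regions (psi :: s) Q = regions s Q.
Proof.
move=> phis c0 /=; elim: s Q phis => // rho s IHs Q; rewrite inE.
case: (eqVneq phi rho) => [<- _|_ /= phis] H /=; last first.
  rewrite addnACA ![(_ `&` [set z | 0 < ev psi z] `&` _)]setIAC.
  rewrite ![(_ `&` [set z | ev psi z < 0] `&` _)]setIAC.
  by congr (_ + _)%N; apply: IHs => // z [Qz _]; exact: H.
have pick (A B : set U) : (forall z, Q z -> A z <-> B z) ->
    regions s (Q `&` A `&` B) = regions s (Q `&` B).
  move=> AB; congr (regions _ _); apply/seteqP; split=> z /=.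
    by move=> [[]].
  by move=> [Qz Bz]; split => //; split => //; apply/AB.
have drop (A B : set U) : (forall z, Q z -> A z -> ~ B z) ->
    regions s (Q `&` A `&` B) = 0%N.
  move=> AB; apply: regions_empty; apply/seteqP; split=> // z [[Qz Az] Bz].
  exact: AB Qz Az Bz.
have [cp|cn|/eqP] := ltrgt0P c; last by rewrite (negbTE c0).
- have E1 := pick [set z | 0 < ev psi z] [set z | 0 < ev phi z].
  have E2 := drop [set z | 0 < ev psi z] [set z | ev phi z < 0].
  have E3 := drop [set z | ev psi z < 0] [set z | 0 < ev phi z].
  have E4 := pick [set z | ev psi z < 0] [set z | ev phi z < 0].
  rewrite /= E1 ?E2 ?E3 ?E4 ?addn0 ?add0n// => z Qz /=; rewrite H//; nra.
- have E1 := drop [set z | 0 < ev psi z] [set z | 0 < ev phi z].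
  have E2 := pick [set z | 0 < ev psi z] [set z | ev phi z < 0].
  have E3 := pick [set z | ev psi z < 0] [set z | 0 < ev phi z].
  have E4 := drop [set z | ev psi z < 0] [set z | ev phi z < 0].
  rewrite /= E1 ?E2 ?E3 ?E4 ?addn0 ?add0n 1?addnC// => z Qz /=; rewrite H//; nra.
Qed.

Lemma regions_zero Q phi s : (forall z, Q z -> ev phi z = 0) ->
  regions (phi :: s) Q = 0%N.
Proof.
by move=> H /=; rewrite !regions_empty//; apply/seteqP; split => // z [/H/= ->];
   rewrite ltxx.
Qed.

(** On the hyperplane of one form of [l] the other forms of [l] become multiples of forms in [s], so
    each restriction sees only [s]. *)
Lemma regions_level M l s : subspace M -> uniq l ->
  (forall psi, psi \in l -> exists2 v, M v & ev psi v != 0) ->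
  (forall psi psi', psi \in l -> psi' \in l -> psi != psi' ->
     exists2 phi, phi \in s & exists2 c : R, c != 0 &
       forall z, ev psi z = 0 -> ev psi' z = c * ev phi z) ->
  regions (l ++ s) M =
  addn (regions s M)
    (\sum_(psi <- l) regions s (M `&` [set z | ev psi z = 0%R]))%N.
Proof.
move=> sM; elim: l => [|psi l IHl]; first by rewrite big_nil addn0.
rewrite cat_cons cons_uniq => /andP[psil ul] ln0 lprop.
rewrite (regions_restriction _ sM (open_convex_self sM)); last first.
  by apply: ln0; rewrite mem_head.
rewrite IHl//; last 2 first.
- by move=> phi phil; apply: ln0; rewrite inE phil orbT.
- by move=> x y xl yl; apply: lprop; rewrite inE ?xl ?yl orbT.
rewrite big_cons -addnA; congr addn; rewrite addnC; congr addn.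
have {}lprop : forall psi', psi' \in l -> exists2 phi, phi \in s &
    exists2 c : R, c != 0 & forall z, ev psi z = 0 -> ev psi' z = c * ev phi z.
  move=> psi' psi'l; apply: lprop; rewrite ?mem_head// ?inE ?psi'l ?orbT//.
  by apply: contraNneq psil => ->.
elim: l {IHl psil ul ln0} lprop => // psi' l IHl lprop.
rewrite cat_cons -IHl; last by move=> x xl; apply: lprop; rewrite inE xl orbT.
have [phi phis [c c0 H]] := lprop psi' (mem_head _ _).
apply: (@regions_proportional _ _ phi c) => //.
  by rewrite mem_cat phis orbT.
by move=> z [_ /=]; exact: H.
Qed.

(** The modularity condition of supersolvable arrangements: two hyperplanes of a level meet inside a
    hyperplane of a lower level. *)
Fixpoint supersolvable (lv : seq (seq F)) : Prop :=
  if lv is l :: lv' then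
    [/\ uniq l,
        (forall psi psi', psi \in l -> psi' \in l -> psi != psi' ->
          exists2 phi, phi \in flatten lv' & exists2 c : R, c != 0 &
            forall z, ev psi z = 0 -> ev psi' z = c * ev phi z)
      & supersolvable lv']
  else True.

(* [e] is the dimension of [Q]; cutting by forms of distinct levels lowers the
   dimension by one at each step, until it is 0. *)
Fixpoint generic (lv : seq (seq F)) Q (e : nat) : Prop :=
  if lv is l :: lv' then
    if e is e'.+1 then
      [/\ forall psi, psi \in l -> exists2 v, Q v & ev psi v != 0,
          generic lv' Q e
        & forall psi, psi \in l -> generic lv' (Q `&` [set z | ev psi z = 0]) e']
    else forall psi z, psi \in flatten lv -> Q z -> ev psi z = 0
  else True.

(** The recursion of [regions_level] for a generic section of dimension [e]. In dimension 0 every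
    form vanishes, so there is one region if all levels are empty and none otherwise. *)
Fixpoint region_count (a : seq nat) (e : nat) : nat :=
  if a is x :: a' then
    if e is e'.+1 then (region_count a' e + x * region_count a' e')%N
    else all (eq_op 0%N) a
  else 1.

Lemma regions_supersolvable lv Q e : subspace Q -> supersolvable lv ->
  generic lv Q e -> regions (flatten lv) Q = region_count (map size lv) e.
Proof.
elim: lv Q e => [|l lv IHlv] Q e sQ; first by rewrite /= asboolT//; exists 0; case: sQ.
move=> [ul lprop slv]; case: e => [|e].
  move=> z0; rewrite -[region_count _ _]/(nat_of_bool (all _ (map size (l :: lv)))).
  have {}z0 psi z : psi \in flatten (l :: lv) -> Q z -> ev psi z = 0 by exact: z0.
  move: (l :: lv) z0 => {IHlv ul lprop slv}lv' z0.
  case E : (flatten lv') => [|phi s]; last first.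
    rewrite -E [LHS](_ : _ = 0%N); last first.
      by rewrite E regions_zero// => z Qz; apply: z0; rewrite // E mem_head.
    case: (boolP (all _ _)) => // alls; suff : flatten lv' = [::] by rewrite E.
    by elim: lv' alls {z0 E} => //= x s' IHs /andP[/eqP/esym/size0nil -> /IHs].
  rewrite (_ : all _ _) /= ?asboolT//; first by exists 0; case: sQ.
  by elim: lv' E {z0} => //= -[|//] s IHs /= /IHs.
move=> [ln0 glv grest]; rewrite [LHS]regions_level// (IHlv _ e.+1)//; congr addn.
rewrite big_seq (eq_bigr (fun=> region_count (map size lv) e)).
  by rewrite -big_seq big_const_seq count_predT iter_addn_0 mulnC.
move=> psi psil; apply: (IHlv) => //; last exact: (grest psi psil).
case: sQ => Q0 QL; split; first by split => //=; rewrite ev0.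
by move=> a u v [Qu u0] [Qv v0]; split; [exact: QL|rewrite /= evL u0 v0 mulr0 addr0].
Qed.

End regions.

(** * Closed form of the number of regions *)

Section altsum.
Context {R : realFieldType}.
Implicit Types (p : {poly R}) (a : seq nat).

(** The sum of the coefficients of index [d - 1], [d - 3], and so on. The guard stops it where
    truncated subtraction would repeat the index 0. *)
Definition altsum p (d : nat) : R := \sum_(0 <= m < d | (2 * m < d)%N) p`_(d - 1 - 2 * m).

Lemma altsum0 p : altsum p 0 = 0. Proof. by rewrite /altsum big_geq. Qed.

Lemma altsum1 p : altsum p 1 = p`_0. Proof. by rewrite /altsum big_mkcond big_nat1. Qed.

Lemma altsumSS p d : altsum p d.+2 = p`_d.+1 + altsum p d.
Proof.
rewrite /altsum big_mkcond big_nat_recl//= subn0 subn1; congr (_ + _).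
rewrite big_nat_recr//= ifF ?addr0; last lia.
rewrite [RHS]big_mkcond; apply: eq_big_nat => m _.
have -> : (2 * m.+1 < d.+2)%N = (2 * m < d)%N by lia.
by case: ifP => // _; congr (_ `_ _); lia.
Qed.

(** This mirrors the recursion of [region_count], with [d] in the role of the codimension. *)
Lemma altsum_mulXD p (x : nat) d :
  altsum (('X + x%:R) * p) d.+1 = altsum p d + x%:R * altsum p d.+1.
Proof.
have cf j : (('X + x%:R) * p)`_j = (if j is i.+1 then p`_i else 0) + x%:R * p`_j.
  by rewrite mulrDl coefD coefXM mulr_natl coefMn mulr_natl; case: j.
(* [altsumSS] moves by two, so the induction carries two consecutive values. *)
suff : altsum (('X + x%:R) * p) d.+1 = altsum p d + x%:R * altsum p d.+1 /\
       altsum (('X + x%:R) * p) d.+2 = altsum p d.+1 + x%:R * altsum p d.+2 by case.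
elim: d => [|d [IH1 IH2]].
  by rewrite !altsumSS !altsum0 !altsum1 !cf /=; split; ring.
by split=> //; rewrite altsumSS IH1 cf [in RHS]altsumSS [altsum p d.+3]altsumSS; ring.
Qed.

Definition mon_poly a : {poly R} := \prod_(x <- a) ('X + x%:R).

(** Coefficients separated by the parity of their degree: half the sum or difference of the values
    at 1 and, up to sign, at -1. *)
Lemma altsum_size a :
  2 * altsum (mon_poly a) (size a) =
    \prod_(x <- a) (1 + x%:R) - \prod_(x <- a) (1 - x%:R) /\
  2 * altsum (mon_poly a) (size a).+1 =
    \prod_(x <- a) (1 + x%:R) + \prod_(x <- a) (1 - x%:R).
Proof.
rewrite /mon_poly; elim: a => [|x a [IH1 IH2]].
  by rewrite !big_nil altsum0 altsum1 coef1 /= mulr1n; split; ring.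
rewrite !big_cons /= !altsum_mulXD.
have -> : altsum (\prod_(j <- a) ('X + j%:R)) (size a).+2 =
          altsum (\prod_(j <- a) ('X + j%:R)) (size a).
  rewrite altsumSS nth_default ?add0r//.
  elim: a {IH1 IH2} => [|y a IHa]; first by rewrite big_nil size_poly1.
  rewrite big_cons (leq_trans (size_polyMleq _ _))//.
  suff : (size ('X + y%:R : {poly R})%R <= 2)%N by move: IHa => /=; lia.
  by rewrite (leq_trans (size_polyD _ _))// geq_max size_polyX/= -polyC_natr
    (leq_trans (size_polyC_leq1 _)).
by split; rewrite mulrDr mulrCA ?IH1 ?IH2; ring.
Qed.

Lemma region_count_large a e : (size a <= e)%N ->
  region_count a e = (\prod_(x <- a) (1 + x))%N.
Proof.
elim: a e => [|x a IHa] e; first by rewrite big_nil.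
case: e => // e /=; rewrite ltnS => ae.
by rewrite !IHa// ?big_cons; [lia|exact: leqW].
Qed.

(* Satisfied by the level sizes of an arrangement: it makes [region_count a 0]
   equal to the product of the [1 - x]. *)
Fixpoint starts_with_one a : Prop :=
  if a is x :: a' then (all (eq_op 0%N) a \/ 1%N \in a) /\ starts_with_one a'
  else True.

(** Both sides obey the same recursion. At [e = size a] both vanish; at [e = 0] the product of the
    [1 - x] is 0 or 1 according to [starts_with_one], exactly as [region_count a 0]. *)
Lemma region_count_altsum a e : starts_with_one a -> (e <= size a)%N ->
  \prod_(x <- a) (1 + x%:R) - (region_count a e)%:R =
  2 * altsum (mon_poly a) (size a - e) :> R.
Proof.
elim: a e => [|x a IHa] e; first by rewrite big_nil /= sub0n altsum0 mulr0 subrr.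
move=> sa; case: e => [_|e].
  rewrite subn0 (altsum_size _).1; congr (_ - _); rewrite /region_count.
  have [[a0|a1] _] := sa.
    rewrite a0 big_seq big1// => y /(allP a0)/eqP<-; exact: subr0.
  rewrite (_ : all _ _ = false); last first.
    by apply/negbTE/allPn; exists 1%N.
  by apply/esym/eqP; rewrite prodf_seq_eq0; apply/hasP; exists 1%N; rewrite //= subrr.
rewrite [region_count _ _]/= [size _]/= ltnS subSS leq_eqVlt => /orP[/eqP ->|ea].
  rewrite subnn altsum0 mulr0 !region_count_large//.
  rewrite big_cons natrD natrM natr_prod.
  by under [in X in _ - (X + _ * X)]eq_bigr do rewrite natrD; ring.
have := IHa e.+1 sa.2 ea; have := IHa e sa.2 (ltnW ea).
have -> : (size a - e = (size a - e.+1).+1)%N by lia.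
rewrite natrD natrM {3}/mon_poly !big_cons altsum_mulXD mulrDr mulrCA => <- <-.
by rewrite -/(mon_poly a); ring.
Qed.

End altsum.

(** * Chambers of a product of reflection groups *)

Section sorting.
Local Open Scope set_scope.
Variable n : nat.
Implicit Types (s : 'S_n) (lt : rel 'I_n) (kappa : 'I_n -> nat).

Lemma card_ord_lt m : (m <= n)%N -> #|[set q : 'I_n | (q < m)%N]| = m.
Proof.
move=> mn; rewrite -sum1_card (eq_bigl (fun q : 'I_n => (q < m)%N)).
  by rewrite -(big_ord_widen n (fun=> 1%N) mn) sum1_card card_ord.
by move=> q; rewrite inE.
Qed.

Lemma downset_ord (A : {set 'I_n}) p :
  (forall q r : 'I_n, (q <= r)%N -> r \in A -> q \in A) -> (p \in A) = (p < #|A|)%N.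
Proof.
move=> dA; apply/idP/idP => pA.
  rewrite -(card_ord_lt (ltn_ord p)); apply: subset_leq_card.
  by apply/fintype.subsetP => q; rewrite inE ltnS => qp; exact: dA qp pA.
apply: contraLR pA => pA; rewrite -leqNgt -[leqRHS](card_ord_lt (ltnW (ltn_ord p))).
apply: subset_leq_card; apply/fintype.subsetP => q qA; rewrite inE ltnNge.
by apply: contra pA => pq; exact: dA pq qA.
Qed.

Lemma sort_perm lt : irreflexive lt -> transitive lt ->
  (forall a b, a != b -> lt a b || lt b a) ->
  exists s, forall p q : 'I_n, (p < q)%N -> lt (s p) (s q).
Proof.
move=> lt_irr lt_tr lt_tot.
have rank_lt a : (#|[set b | lt b a]| < n)%N.
  rewrite -[X in (_ < X)%N]card_ord -cardsT; apply: proper_card.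
  by rewrite properT; apply/negP => /eqP/setP/(_ a); rewrite !inE lt_irr.
pose rank a := Ordinal (rank_lt a).
have rank_mono a b : lt a b -> (rank a < rank b)%N.
  move=> ab; apply: proper_card; apply/properP; split.
    by apply/fintype.subsetP => c; rewrite !inE => /lt_tr; exact.
  by exists a; rewrite !inE ?lt_irr.
have rank_inj : injective rank.
  move=> a b ab; apply/eqP; apply/negPn/negP => /lt_tot/orP[] /rank_mono;
  by rewrite ab ltnn.
exists (perm rank_inj)^-1%g => p q pq.
set a := _ p; set b := _ q.
have ra : rank a = p by rewrite -[rank a](permE rank_inj) permKV.
have rb : rank b = q by rewrite -[rank b](permE rank_inj) permKV.
have /lt_tot/orP[//|/rank_mono] : a != b.
  by apply: contraTneq pq => ab; rewrite -ra -rb ab ltnn.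
by rewrite ra rb; lia.
Qed.

Lemma sort_perm_uniq lt s s' : irreflexive lt -> transitive lt ->
  (forall p q : 'I_n, (p < q)%N -> lt (s p) (s q)) ->
  (forall p q : 'I_n, (p < q)%N -> lt (s' p) (s' q)) -> s = s'.
Proof.
move=> lt_irr lt_tr.
have rank (t : {perm _}) p : (forall p q : 'I_n, (p < q)%N -> lt (t p) (t q)) ->
    #|[set b | lt b (t p)]| = p :> nat.
  move=> lt_t; rewrite -[RHS](card_ord_lt (ltnW (ltn_ord p))).
  rewrite -[in RHS](card_imset _ (@perm_inj _ t)); congr #|pred_of_set _|.
  apply/setP => b; rewrite inE. apply/idP/imsetP => [bp|[q + ->]].
    exists (t^-1%g b); rewrite ?permKV// inE ltnNge.
    apply/negP; rewrite leq_eqVlt => /orP[/eqP/val_inj E|/lt_t].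
      by move: bp; rewrite E permKV lt_irr.
    by rewrite permKV => /(lt_tr _ _ _ bp); rewrite lt_irr.
  by rewrite inE; exact: lt_t.
move=> lt_s lt_s'; apply/permP => p.
have := rank s' (s'^-1%g (s p)) lt_s'; rewrite permKV rank// => /val_inj/(congr1 s').
by rewrite permKV.
Qed.

Lemma count_perm_lt kappa s b p :
  (forall p q : 'I_n, (p <= q)%N -> (kappa (s p) <= kappa (s q))%N) ->
  (kappa (s p) < b)%N = (p < #|[set a | (kappa a < b)%N]|)%N.
Proof.
move=> ks; rewrite -(card_imset _ (@perm_inj _ s^-1%g)) -downset_ord.
  by apply/idP/imsetP => [pb|[a + ->]]; [exists (s p)|]; rewrite ?inE ?permK ?permKV.
move=> q r qr /imsetP[a]; rewrite inE => ab E.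
apply/imsetP; exists (s q); rewrite ?permK// inE (leq_ltn_trans (ks _ _ qr))//.
by rewrite E permKV.
Qed.

Lemma sort_perm_nat kappa :
  exists s, forall p q : 'I_n, (p <= q)%N -> (kappa (s p) <= kappa (s q))%N.
Proof.
pose lt (a b : 'I_n) := ((kappa a < kappa b) || ((kappa a == kappa b) && (a < b)))%N.
have [||a b|s lts] := @sort_perm lt.
- by move=> a; rewrite /lt !ltnn andbF.
- by move=> b a c; rewrite /lt; lia.
- by rewrite /lt -val_eqE /=; lia.
exists s => p q; rewrite leq_eqVlt => /orP[/eqP/val_inj ->//|/lts].
by rewrite /lt; lia.
Qed.

End sorting.

(** * Chambers, their walls and the levels of the arrangement *)

Section chambers.
Local Open Scope set_scope.
Context {R : realFieldType} {n k : nat}.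
Variable i : 'I_k.+1 -> nat.
Hypothesis i_incr : forall a b : 'I_k.+1, (a < b)%N -> (i a < i b)%N.
Hypothesis i_le_n : forall a : 'I_k.+1, (i a <= n)%N.
Implicit Types (y z : 'rV[R]_n) (h : {perm 'I_n} * {ffun 'I_n -> bool}).

Definition vertex (p : nat) := [exists l, i l == p].
(** Coordinate [p] belongs to the step from S_p to S_(p+1). Blocks are numbered from 0, before the
    first vertex, to [k.+1], after the last one. *)
Definition block (p : nat) := #|[set l | (i l <= p)%N]|.

Lemma i_mono (a b : 'I_k.+1) : (a <= b)%N -> (i a <= i b)%N.
Proof. by rewrite leq_eqVlt => /orP[/eqP/val_inj ->//|/i_incr/ltnW]. Qed.

Lemma block_mono p q : (p <= q)%N -> (block p <= block q)%N.
Proof.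
move=> pq; apply: subset_leq_card; apply/fintype.subsetP => l.
by rewrite !inE => /leq_trans; exact.
Qed.

Lemma block_eq p q : (p <= q)%N ->
  reflect (forall l, (i l <= q)%N -> (i l <= p)%N) (block p == block q).
Proof.
move=> pq; apply: (iffP idP) => [/eqP E l lq|H].
  have /subset_cardP/(_ _)/(_ l) := E; rewrite !inE lq; apply.
  by apply/fintype.subsetP => l'; rewrite !inE => /leq_trans; exact.
rewrite /block; apply/eqP/eq_card => l; rewrite !inE.
by apply/idP/idP => [/leq_trans|]; [exact|exact: H].
Qed.

Lemma block_eq_vertex p q : (p < q)%N ->
  reflect (forall r, (p < r <= q)%N -> ~~ vertex r) (block p == block q).
Proof.
move=> pq; apply: (iffP (block_eq (ltnW pq))) => [H r /andP[pr rq]|H l lq].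
  by apply/existsP => -[l /eqP lr]; have := H l; lia.
rewrite leqNgt; apply/negP => pl; have := H (i l); rewrite pl lq => /(_ isT)/negP.
by apply; apply/existsP; exists l.
Qed.

Lemma first_block p : (p < i ord0)%N = (block p == 0%N).
Proof.
rewrite cards_eq0; apply/idP/eqP => [p0|/finset.setP/(_ ord0)].
  apply/finset.setP => l; rewrite !inE leqNgt; apply/negbTE; rewrite negbK.
  by apply: (leq_trans p0); exact: i_mono.
by rewrite !inE leqNgt => /negbT; rewrite negbK.
Qed.

Lemma last_block p : (i ord_max <= p)%N = (block p == k.+1).
Proof.
rewrite -[X in _ == X]card_ord -cardsT.
apply/idP/eqP => [pm|].
  apply/eq_card => l; rewrite !inE; apply: leq_trans pm; apply: i_mono.
  by rewrite -ltnS ltn_ord.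
apply: contra_eqT; rewrite -ltnNge => pm; rewrite neq_ltn; apply/orP; left.
apply: proper_card; rewrite properT; apply/negP => /eqP/finset.setP/(_ ord_max).
by rewrite !inE leqNgt pm.
Qed.

Lemma block_sides p q : block p = block q ->
  ((p < i ord0) = (q < i ord0))%N /\ ((i ord_max <= p) = (i ord_max <= q))%N.
Proof. by move=> pq; rewrite !first_block !last_block pq. Qed.

(* Coordinates are shifted by one and padded with [y_0 = y_(n+1) = 0]. *)
Definition pad y (p : nat) : R :=
  if p is q.+1 then (if insub q is Some j then y 0 j else 0) else 0.

Lemma padS y (j : 'I_n) : pad y j.+1 = y 0 j.
Proof. by rewrite /pad valK. Qed.

Lemma pad_last y : pad y n.+1 = 0.
Proof. by rewrite /pad insubF// ltnn. Qed.

(** The increment at [p] is the coefficient of c - f(S_p) when [y] is paired with the walk by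
    summation by parts. At a vertex this weight vanishes, so the increment is left free. *)
Definition base_chamber y :=
  forall p, (p <= n)%N -> ~~ vertex p -> pad y p < pad y p.+1.

Lemma pad_lt y p q : base_chamber y -> (p < q <= n.+1)%N ->
  (forall r, (p <= r < q)%N -> ~~ vertex r) -> pad y p < pad y q.
Proof.
move=> By; elim: q => // q IHq /andP[pq qn] nv.
have : pad y q < pad y q.+1 by apply: By => //; apply: nv; lia.
move: pq; rewrite ltnS leq_eqVlt => /orP[/eqP->//|pq].
by apply: lt_trans; apply: IHq; [lia|move=> r ?; apply: nv; lia].
Qed.

(** The padding zeros turn monotonicity at the two ends into sign conditions; this is why sign
    changes enter in the first and last block. *)
Lemma base_chamberP y : base_chamber y <->
  [/\ forall p q : 'I_n, (p < q)%N -> block p = block q -> y 0 p < y 0 q,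
      forall p : 'I_n, (p < i ord0)%N -> 0 < y 0 p
    & forall p : 'I_n, (i ord_max <= p)%N -> y 0 p < 0].
Proof.
split=> [By|[Hin Hfst Hlst] p pn pv].
  split=> [p q pq /eqP/(block_eq_vertex pq) nv|p p0|p pm].
  - by rewrite -!padS; apply: pad_lt => //; move: (ltn_ord q); lia.
  - rewrite -padS -[0]/(pad y 0); apply: pad_lt => // [|r rp].
      by have := ltn_ord p; lia.
    by apply/existsP => -[l /eqP lr]; have := @i_mono ord0 l (leq0n _); lia.
  - rewrite -padS -[ltRHS](pad_last y); apply: pad_lt => // [|r rp].
      by have := ltn_ord p; lia.
    apply/existsP => -[l /eqP lr].
    by have := @i_mono l ord_max (ltn_ord l); lia.
have iv l : i l != p by apply: contra pv => lp; apply/existsP; exists l.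
have [pn1|pn1] := ltnP p n; last first.
  have pE : p = n by lia.
  rewrite {2}pE pad_last; have := iv ord_max; have := i_le_n ord_max.
  case: p pE {pn iv pn1 pv} => [|p] pE; first lia.
  move=> ln ln'; have pn : (p < n)%N by lia.
  by rewrite -[p]/(val (Ordinal pn)) padS Hlst//=; lia.
have pS : pad y p.+1 = y 0 (Ordinal pn1) by rewrite -padS.
rewrite pS; case: p pn iv pn1 pv pS => [|p] pn iv pn1 pv pS.
  by apply: Hfst => /=; have := iv ord0; lia.
have pn' : (p < n)%N by lia.
rewrite -[p]/(val (Ordinal pn')) padS; apply: Hin => //=.
apply/eqP/block_eq => // l lp; have := iv l; lia.
Qed.

Definition chamber h z := base_chamber (\row_p ((-1) ^+ h.2 p * z 0 (h.1 p))).

Definition sign_allowed (p : nat) := (p < i ord0)%N || (i ord_max <= p)%N.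

Definition block_group h :=
  [forall p, (block (h.1 p) == block p) && (h.2 p ==> sign_allowed p)].

Definition form := ('I_n * option (bool * 'I_n))%type.
Implicit Type phi : form.

(** Asking for [b < phi.1] lists each hyperplane once and makes its larger coordinate the level. *)
Definition form_ok phi :=
  if phi.2 is Some (e, b) then
    [&& (b < phi.1)%N, block b == block phi.1 & e ==> sign_allowed phi.1]
  else sign_allowed phi.1.

Definition form_val phi z : R :=
  z 0 phi.1 - (if phi.2 is Some (e, b) then (-1) ^+ e * z 0 b else 0).

Lemma form_val_linear phi a y z :
  form_val phi (a *: y + z) = a * form_val phi y + form_val phi z.
Proof. by rewrite /form_val; case: phi => c [[e b]|] /=; rewrite !mxE; ring. Qed.

Lemma block_group_perm h p : block_group h -> block (h.1 p) = block p.
Proof. by move=> /forallP/(_ p)/andP[/eqP]. Qed.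

Lemma block_group_sign h p : block_group h -> h.2 p -> sign_allowed p.
Proof. by move=> /forallP/(_ p)/andP[_ /implyP]. Qed.

Lemma sign_allowed_block p q : block p = block q -> sign_allowed p = sign_allowed q.
Proof. by move=> /block_sides[E1 E2]; rewrite /sign_allowed E1 E2. Qed.

Lemma chamber_coord h z (p : 'I_n) : block_group h -> chamber h z ->
  [/\ forall q : 'I_n, (p < q)%N -> block p = block q ->
        (-1) ^+ h.2 p * z 0 (h.1 p) < (-1) ^+ h.2 q * z 0 (h.1 q),
      (p < i ord0)%N -> 0 < (-1) ^+ h.2 p * z 0 (h.1 p)
    & (i ord_max <= p)%N -> (-1) ^+ h.2 p * z 0 (h.1 p) < 0].
Proof.
move=> Gh /base_chamberP[H1 H2 H3]; split.
- by move=> q pq /(H1 _ _ pq); rewrite !mxE.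
- by move=> /H2; rewrite mxE.
- by move=> /H3; rewrite mxE.
Qed.

(** Pulled back by [h], a form is up to sign a coordinate, a difference or a sum of two coordinates
    of a vector of the base chamber; sums occur only where both coordinates have the same known
    sign. *)
Lemma chamber_form_sign h phi : block_group h -> form_ok phi ->
  (forall z, chamber h z -> 0 < form_val phi z) \/
  (forall z, chamber h z -> form_val phi z < 0).
Proof.
move=> Gh; case: phi => a [[eps b]|]; rewrite /form_ok /form_val /=; last first.
  have := block_group_perm (h.1^-1%g a) Gh; rewrite permKV => /sign_allowed_block ->.
  set p := (h.1^-1)%g a => pok.
  have Kz z (Kz : chamber h z) := chamber_coord p Gh Kz.
  have hp : h.1 p = a by rewrite permKV.
  rewrite hp in Kz; move: pok => /orP[p0|pm]; case: (h.2 p) Kz => Kz.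
  - by right=> z /Kz[_ /(_ p0) + _]; lra.
  - by left=> z /Kz[_ /(_ p0) + _]; lra.
  - by left=> z /Kz[_ _ /(_ pm)]; lra.
  - by right=> z /Kz[_ _ /(_ pm)]; lra.
case/and3P => ba /eqP bab.
have := block_group_perm (h.1^-1%g a) Gh; rewrite permKV => pa.
have := block_group_perm (h.1^-1%g b) Gh; rewrite permKV => qb.
rewrite (sign_allowed_block pa) => /implyP eok.
have {pa qb}: block (h.1^-1%g a) = block (h.1^-1%g b) by rewrite -pa -qb.
have : h.1^-1%g a != h.1^-1%g b.
  by apply: contraTneq ba => /perm_inj ->; rewrite ltnn.
move: eok; set p := (h.1^-1)%g a; set q := (h.1^-1)%g b => eok pq bpq.
have hp : h.1 p = a by rewrite permKV.
have hq : h.1 q = b by rewrite permKV.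
pose yp z := (-1) ^+ h.2 p * z 0 a; pose yq z := (-1) ^+ h.2 q * z 0 b.
have [p0E pmE] := block_sides bpq.
have Kpq : (forall z, chamber h z -> yp z < yq z) \/
           (forall z, chamber h z -> yq z < yp z).
  have := pq; rewrite -val_eqE neq_ltn /= => /orP[lt|lt]; [left|right] => z Kz.
    by have [/(_ q lt bpq) + _ _] := chamber_coord p Gh Kz; rewrite hp hq.
  by have [/(_ p lt (esym bpq)) + _ _] := chamber_coord q Gh Kz; rewrite hp hq.
(* In an inner block there are no sign changes and the form is a plain difference. *)
have [pok|pnok] := boolP (sign_allowed p); last first.
  have -> : eps = false by apply: contraNF pnok.
  have /negbTE e1 : ~~ h.2 p by apply: contra pnok; exact: block_group_sign.
  have /negbTE e2 : ~~ h.2 q.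
    apply: contra pnok; rewrite (sign_allowed_block bpq); exact: block_group_sign.
  by move: Kpq; rewrite /yp /yq e1 e2 => -[] Kpq; [right|left] => z /Kpq; lra.
(* In an outer block the two unfolded values share a sign, which fixes the sign of their sum as
   well. *)
have Ksg : (forall z, chamber h z -> 0 < yp z /\ 0 < yq z) \/
           (forall z, chamber h z -> yp z < 0 /\ yq z < 0).
  have := pok => /orP[lt|lt]; [left|right] => z Kz.
    have [_ + _] := chamber_coord p Gh Kz; have [_ + _] := chamber_coord q Gh Kz.
    by rewrite hp hq -p0E lt /yp /yq => /(_ isT) + /(_ isT).
  have [_ _] := chamber_coord p Gh Kz; have [_ _] := chamber_coord q Gh Kz.
  by rewrite hp hq -pmE lt /yp /yq => /(_ isT) + /(_ isT).
move: Kpq Ksg; rewrite /yp /yq {eok}; case: eps; case: (h.2 p); case: (h.2 q);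
move=> [Kpq|Kpq] [Ksg|Ksg];
first [by left => z Kz; have := Kpq z Kz; have [] := Ksg z Kz; lra
      |by right => z Kz; have := Kpq z Kz; have [] := Ksg z Kz; lra].
Qed.

Lemma chamber_same_side h z z' : block_group h -> chamber h z ->
  (forall phi, form_ok phi -> (0 < form_val phi z -> 0 < form_val phi z') /\
     (form_val phi z < 0 -> form_val phi z' < 0)) ->
  chamber h z'.
Proof.
move=> Gh /base_chamberP[H1 H2 H3] zz'; apply/base_chamberP.
have one (p : 'I_n) : sign_allowed p ->
    (0 < (-1) ^+ h.2 p * z 0 (h.1 p) -> 0 < (-1) ^+ h.2 p * z' 0 (h.1 p)) /\
    ((-1) ^+ h.2 p * z 0 (h.1 p) < 0 -> (-1) ^+ h.2 p * z' 0 (h.1 p) < 0).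
  move=> pok; have [|] := zz' (h.1 p, None).
    by rewrite /form_ok /= (sign_allowed_block (block_group_perm p Gh)).
  rewrite /form_val /= !subr0; case: (h.2 p); rewrite ?mul1r ?mulN1r//.
  by rewrite !oppr_gt0 !oppr_lt0.
split=> [p q pq bpq|p p0|p pm]; rewrite !mxE.
- have := H1 p q pq bpq; rewrite !mxE.
  have pa := block_group_perm p Gh; have qb := block_group_perm q Gh.
  have eok : h.2 p + h.2 q ==> sign_allowed p.
    apply/implyP => e; case: (boolP (h.2 p)) => [/(block_group_sign Gh)//|/negbTE e1].
    rewrite (sign_allowed_block bpq); apply: (block_group_sign Gh).
    by move: e; rewrite e1.
  have : h.1 p != h.1 q by apply: contraTneq pq => /perm_inj ->; rewrite ltnn.
  rewrite -val_eqE neq_ltn /= => /orP[lt|lt].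
    have [|] := zz' (h.1 q, Some (h.2 p (+) h.2 q, h.1 p)).
      rewrite /form_ok /= lt pa qb bpq eqxx /=.
      by rewrite (sign_allowed_block qb) -(sign_allowed_block bpq).
    rewrite /form_val /=; case: (h.2 p); case: (h.2 q) => /= F1 F2 ltz;
    by first [have := F1 ltac:(lra); lra|have := F2 ltac:(lra); lra].
  have [|] := zz' (h.1 p, Some (h.2 p (+) h.2 q, h.1 q)).
    rewrite /form_ok /= lt pa qb bpq eqxx /=.
    by rewrite (sign_allowed_block pa).
  rewrite /form_val /=; case: (h.2 p); case: (h.2 q) => /= F1 F2 ltz;
  by first [have := F1 ltac:(lra); lra|have := F2 ltac:(lra); lra].
- by have := H2 p p0; rewrite !mxE; apply: (one p _).1; rewrite /sign_allowed p0.
- by have := H3 p pm; rewrite !mxE; apply: (one p _).2; rewrite /sign_allowed pm orbT.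
Qed.

(* The value of [z] at [a] after the sign change that moves it to the base
   chamber; a chamber containing [z] is found by sorting these values. *)
Definition folded z (a : 'I_n) : R :=
  if (a < i ord0)%N then `|z 0 a| else if (i ord_max <= a)%N then - `|z 0 a| else z 0 a.

Definition folded_lt z : rel 'I_n := fun a b =>
  (block a < block b)%N || (block a == block b) && (folded z a < folded z b).

Lemma folded_lt_irr z : irreflexive (folded_lt z).
Proof. by move=> a; rewrite /folded_lt ltnn ltxx andbF. Qed.

Lemma folded_lt_tr z : transitive (folded_lt z).
Proof.
move=> b a c; rewrite /folded_lt => /orP[ab|/andP[/eqP-> ab]] /orP[bc|/andP[/eqP bc' bc]].
- by rewrite (ltn_trans ab bc).
- by rewrite -bc' ab.
- by rewrite bc.
- by rewrite bc' eqxx (lt_trans ab bc) orbT.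
Qed.

Lemma folded_chamber h z p : block_group h -> chamber h z ->
  folded z (h.1 p) = (-1) ^+ h.2 p * z 0 (h.1 p).
Proof.
move=> Gh Kz; have [_ Hf Hl] := chamber_coord p Gh Kz.
rewrite /folded; have [-> ->] := block_sides (block_group_perm p Gh).
have nrm : `|(-1) ^+ h.2 p * z 0 (h.1 p)| = `|z 0 (h.1 p)| by rewrite normrMsign.
case: ltnP => [p0|p0].
  by rewrite -nrm gtr0_norm// Hf.
case: leqP => pm; first by rewrite -nrm ltr0_norm ?opprK// Hl.
case: (boolP (h.2 p)) => [/(block_group_sign Gh)|_]; last by rewrite mul1r.
by rewrite /sign_allowed; lia.
Qed.

Lemma chamber_sorted h z (p q : 'I_n) : block_group h -> chamber h z ->
  (p < q)%N -> folded_lt z (h.1 p) (h.1 q).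
Proof.
move=> Gh Kz pq; rewrite /folded_lt !block_group_perm// !folded_chamber//.
have := block_mono (ltnW pq); rewrite leq_eqVlt => /orP[/eqP E|->//].
by have [/(_ q pq E) -> _ _] := chamber_coord p Gh Kz; rewrite E eqxx orbT.
Qed.

(** The permutation sorts the coordinates of [z] by block and folded value, hence is unique; the
    signs are then read off from the folded values. *)
Lemma chamber_uniq h h' z : block_group h -> block_group h' ->
  chamber h z -> chamber h' z -> h = h'.
Proof.
move=> Gh Gh' Kz Kz'.
have E1 : h.1 = h'.1.
  apply: (sort_perm_uniq (@folded_lt_irr z) (@folded_lt_tr z)) => p q pq;
  exact: chamber_sorted.
rewrite [h]surjective_pairing [h']surjective_pairing E1; congr pair.
apply/ffunP => p; have := folded_chamber p Gh Kz; have := folded_chamber p Gh' Kz'.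
rewrite E1 => -> /esym.
have [pok|pnok] := boolP (sign_allowed p); last first.
  move=> _; transitivity false; [|apply/esym];
  by apply: contraNF pnok; exact: block_group_sign.
have z0 : z 0 (h'.1 p) != 0.
  have [_ Hf Hl] := chamber_coord p Gh' Kz'; move: pok => /orP[/Hf|/Hl];
  by apply: contraTneq => ->; rewrite mulr0 ltxx.
move=> /(mulIf z0); case: (h.2 p); case: (h'.2 p) => //=; lra.
Qed.

Lemma chamber_exists z : (forall phi, form_ok phi -> form_val phi z != 0) ->
  exists2 h, block_group h & chamber h z.
Proof.
move=> z0.
(* Equal folded values inside a block would make [z] a zero of an allowed form. *)
have tot (a b : 'I_n) : a != b -> folded_lt z a b || folded_lt z b a.
  wlog : a b / (b < a)%N.
    move=> wl ab; have := ab; rewrite -val_eqE neq_ltn => /orP[|] lt; last exact: wl.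
    by rewrite orbC; apply: wl => //; rewrite eq_sym.
  move=> lt _; rewrite /folded_lt.
  case: (ltngtP (block a) (block b)) => //= ab; rewrite -neq_lt /folded.
  have [-> ->] := block_sides ab; apply/eqP => E.
  have [bok|bnok] := boolP (sign_allowed a).
    have := z0 (a, Some (false, b)); have := z0 (a, Some (true, b)).
    rewrite /form_ok /form_val /= lt ab eqxx bok /= expr0 expr1 mul1r mulN1r.
    move=> /(_ isT) H1 /(_ isT) H2.
    have /eqP : `|z 0 a| = `|z 0 b|.
      move: E bok; rewrite /sign_allowed; have [-> ->] := block_sides ab.
      by case: ltnP => //= _; case: leqP => // _ /oppr_inj.
    rewrite eqr_norm2 => /orP[|] /eqP E'.
      by move: H2; rewrite E'; apply/negP; rewrite negbK; apply/eqP; ring.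
    by move: H1; rewrite E'; apply/negP; rewrite negbK; apply/eqP; ring.
  have := z0 (a, Some (false, b)); rewrite /form_ok /form_val /= lt ab eqxx expr0 mul1r.
  move=> /(_ isT); apply/negP; rewrite negbK; apply/eqP.
  move: E bnok; rewrite /sign_allowed; have [-> ->] := block_sides ab.
  by case: ltnP => //= _; case: leqP => // _ -> _; ring.
have [s ss] := sort_perm (@folded_lt_irr z) (@folded_lt_tr z) tot.
have ble (p q : 'I_n) : (p <= q)%N -> (block (s p) <= block (s q))%N.
  rewrite leq_eqVlt => /orP[/eqP/val_inj ->//|/ss].
  by rewrite /folded_lt => /orP[/ltnW//|/andP[/eqP->]].
(* Both [s] and the identity sort [block], so they agree on the number of positions below each block
   number. *)
have bs (p : 'I_n) : block (s p) = block p.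
  have H b : (block (s p) < b)%N = (block p < b)%N.
    rewrite (@count_perm_lt _ (fun a => block a))//.
    rewrite -(@count_perm_lt _ (fun a => block a) 1%g) ?perm1//.
    by move=> q r qr; rewrite !perm1; exact: block_mono.
  have := H (block p); have := H (block p).+1; rewrite !ltnS leqnn ltnn; lia.
pose e := [ffun p : 'I_n => if (p < i ord0)%N then z 0 (s p) < 0
   else if (i ord_max <= p)%N then 0 < z 0 (s p) else false].
have fe (p : 'I_n) : folded z (s p) = (-1) ^+ e p * z 0 (s p).
  rewrite /folded ffunE; have [-> ->] := block_sides (bs p).
  case: ltnP => _; first exact: normrEsign.
  by case: leqP => _; rewrite ?mul1r// -normrN normrEsign oppr_lt0 mulrN opprK.
have nz (p : 'I_n) : sign_allowed p -> z 0 (s p) != 0.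
  move=> pok; have := z0 (s p, None); rewrite /form_ok /form_val /= subr0; apply.
  by rewrite (sign_allowed_block (bs p)).
exists (s, e).
  apply/forallP => p /=; rewrite bs eqxx ffunE /sign_allowed.
  case: ltnP => _ /=; first by rewrite implybT.
  by case: leqP => _ /=; rewrite ?implybT.
apply/base_chamberP; split=> [p q pq bpq|p p0|p pm]; rewrite !mxE -!fe.
- by have := ss p q pq; rewrite /folded_lt !bs bpq ltnn eqxx.
- rewrite /folded; have [-> _] := block_sides (bs p); rewrite p0 normr_gt0.
  by apply: nz; rewrite /sign_allowed p0.
- rewrite /folded; have [-> ->] := block_sides (bs p); rewrite pm.
  rewrite ltnNge (leq_trans _ pm) ?i_mono//= oppr_lt0 normr_gt0.
  by apply: nz; rewrite /sign_allowed pm orbT.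
Qed.

Definition met_chambers (Q : set 'rV[R]_n) : nat :=
  #|[set h | block_group h & `[<exists z, Q z /\ chamber h z>]]|.

(** Every chamber lies on one side of each form, so cutting [Q] by a form partitions the chambers it
    meets. The allowed forms outside [s] keep a constant sign on [Q]; once [s] is exhausted, a
    nonempty [Q] lies in exactly one chamber. *)
Lemma met_chambers_regions (Q : set 'rV[R]_n) (s : seq form) :
  (forall phi, phi \in s -> form_ok phi) ->
  (forall phi, form_ok phi -> phi \in s \/
     (forall z, Q z -> 0 < form_val phi z) \/ (forall z, Q z -> form_val phi z < 0)) ->
  met_chambers Q = regions form_val s Q.
Proof.
elim: s Q => [|phi s IHs] Q sok Qs; last first.
  have phiok : form_ok phi by apply: sok; rewrite mem_head.
  rewrite /=.
  have <- : met_chambers (Q `&` [set z | 0 < form_val phi z]%classic) =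
      regions form_val s (Q `&` [set z | 0 < form_val phi z]%classic).
    apply: IHs => [x xs|x /Qs[|[|]]]; first by apply: sok; rewrite inE xs orbT.
    - by rewrite inE => /orP[/eqP->|]; [right; left => z []|left].
    - by move=> H; right; left => z [/H].
    - by move=> H; right; right => z [/H].
  have <- : met_chambers (Q `&` [set z | form_val phi z < 0]%classic) =
      regions form_val s (Q `&` [set z | form_val phi z < 0]%classic).
    apply: IHs => [x xs|x /Qs[|[|]]]; first by apply: sok; rewrite inE xs orbT.
    - by rewrite inE => /orP[/eqP->|]; [right; right => z []|left].
    - by move=> H; right; left => z [/H].
    - by move=> H; right; right => z [/H].
  rewrite /met_chambers -cardsUI [X in (_ + X)%N](_ : _ = 0%N) ?addn0.
    congr #|pred_of_set _|; apply/finset.setP => h; rewrite !inE.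
    case: (boolP (block_group h)) => //= Gh; apply/idP/idP.
      move=> /asboolP[z [Qz Kz]]; apply/orP.
      have [H|H] := chamber_form_sign Gh phiok; [left|right]; apply/asboolP; exists z;
      by split=> //; split=> //=; exact: H.
    by move=> /orP[] /asboolP[z [[Qz _] Kz]]; apply/asboolP; exists z.
  apply/eqP; rewrite cards_eq0; apply/eqP/finset.setP => h; rewrite !inE.
  apply/negbTE/negP => /andP[/andP[Gh /asboolP[z [[Qz /= z0] Kz]]]].
  move=> /andP[_ /asboolP[z' [[Qz' /= z0'] Kz']]].
  have [H|H] := chamber_form_sign Gh phiok; first by have := H _ Kz'; lra.
  by have := H _ Kz; lra.
rewrite /=; case: asboolP => [[z Qz]|Q0]; last first.
  rewrite /met_chambers; apply/eqP; rewrite cards_eq0; apply/eqP/finset.setP => h.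
  rewrite !inE; apply/negbTE/negP => /andP[_ /asboolP[z [Qz _]]].
  by apply: Q0; exists z.
have z0 phi : form_ok phi -> form_val phi z != 0.
  by move=> /Qs[//|[H|H]]; have := H z Qz; [exact: lt0r_neq0|exact: ltr0_neq0].
have [h Gh Kz] := chamber_exists z0.
rewrite /met_chambers [X in #|pred_of_set X|](_ : _ = [set h]) ?cards1//.
apply/finset.setP => h'; rewrite !inE; apply/idP/eqP => [/andP[Gh']|->].
  move=> /asboolP[z' [Qz' Kz']]; apply: (@chamber_uniq _ _ z) => //.
  apply: (@chamber_same_side _ z') => // phi /Qs[//|[H|H]].
    by have := H z Qz; have := H z' Qz'; split=> //; lra.
  by have := H z Qz; have := H z' Qz'; split=> //; lra.
by rewrite Gh; apply/asboolP; exists z.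
Qed.

Definition form_level (p : nat) : seq form :=
  [seq phi <- enum {: form} | form_ok phi && (phi.1 == p :> nat)].

Fixpoint form_levels (p : nat) : seq (seq form) :=
  if p is q.+1 then form_level q :: form_levels q else [::].

Lemma mem_form_level p phi :
  (phi \in form_level p) = form_ok phi && (phi.1 == p :> nat).
Proof. by rewrite mem_filter mem_enum andbT. Qed.

Lemma mem_form_levels p phi :
  (phi \in flatten (form_levels p)) = form_ok phi && (phi.1 < p)%N.
Proof.
elim: p => [|p IHp] /=; first by rewrite ltn0 andbF.
by rewrite mem_cat IHp mem_form_level -andb_orr ltnS [in RHS]leq_eqVlt.
Qed.

(** Eliminating the top coordinate between two forms of its level leaves a multiple of [z_b], or of
    a sum or difference of [z_b] and [z_b'], with smaller indices in the same block. *)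
Lemma form_levels_supersolvable p : supersolvable form_val (form_levels p).
Proof.
elim: p => //= p IHp; split=> //; first by rewrite filter_uniq// enum_uniq.
move=> [a o] [a' o']; rewrite !mem_form_level /= => /andP[ok /eqP ap] /andP[ok' /eqP ap'].
have {ap'} E : a = a' by apply: val_inj; rewrite /= ap ap'.
move: ok'; rewrite -E => {E} ok'.
have sa (b : 'I_n) : block b = block a -> sign_allowed b = sign_allowed a.
  exact: sign_allowed_block.
case: o o' ok ok' => [[e b]|] [[e' b']|] //=; rewrite /form_ok /=.
- move=> /and3P[ba /eqP bab /implyP eok] /and3P[b'a /eqP b'ab /implyP e'ok] ne.
  have eeok : e (+) e' -> sign_allowed a.
    by case: (boolP e) => [/eok//|_]; exact: e'ok.
  have [bb'|b'b|bb'] := ltngtP b b'.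
  + exists (b', Some (e (+) e', b)).
      rewrite mem_form_levels /form_ok /= bb' bab b'ab eqxx sa// -ap b'a andbT.
      exact/implyP.
    exists (- (-1) ^+ e'); first by rewrite oppr_eq0 signr_eq0.
    move=> z; rewrite /form_val /=; case: (e); case: (e') => /=; lra.
  + exists (b, Some (e (+) e', b')).
      rewrite mem_form_levels /form_ok /= b'b bab b'ab eqxx sa// -ap ba andbT.
      exact/implyP.
    exists ((-1) ^+ e); first by rewrite signr_eq0.
    move=> z; rewrite /form_val /=; case: (e); case: (e') => /=; lra.
  (* The forms [z_a - z_b] and [z_a + z_b] meet on [z_b = 0]; this is the origin of the factor 2. *)
  + have {}bb' : b = b' by exact: val_inj.
    rewrite -bb' in ne *.
    have ee : e (+) e' by move: ne; case: (e); case: (e'); rewrite // eqxx.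
    exists (b, None).
      by rewrite mem_form_levels /form_ok /= sa// -ap ba andbT; exact: eeok.
    exists (2 * (-1) ^+ e); first by rewrite mulf_neq0// ?signr_eq0// pnatr_eq0.
    move=> z; rewrite /form_val /=; move: ee; case: (e); case: (e') => //= _; lra.
- move=> /and3P[ba /eqP bab _] aok _; exists (b, None).
    by rewrite mem_form_levels /form_ok /= sa// aok -ap.
  exists ((-1) ^+ e); first by rewrite signr_eq0.
  by move=> z; rewrite /form_val /=; case: (e) => /=; lra.
- move=> aok /and3P[ba /eqP bab _] _; exists (b', None).
    by rewrite mem_form_levels /form_ok /= sa// aok -ap.
  exists (- (-1) ^+ e'); first by rewrite oppr_eq0 signr_eq0.
  by move=> z; rewrite /form_val /=; case: (e') => /=; lra.
- by rewrite eqxx.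
Qed.

Lemma met_chambers_count (M : set 'rV[R]_n) e : subspace M ->
  generic form_val (form_levels n) M e ->
  met_chambers M = region_count (map size (form_levels n)) e.
Proof.
move=> sM gM; rewrite -(regions_supersolvable form_val_linear sM _ gM).
  apply: met_chambers_regions => phi; first by rewrite mem_form_levels => /andP[].
  by move=> ok; left; rewrite mem_form_levels ok /=.
exact: form_levels_supersolvable.
Qed.

End chambers.

(** * Generic sections *)

Section general_position.
Context {R : realFieldType} {n d : nat}.
Implicit Types (X : 'M[R]_(n, d)) (C : 'M[R]_(d, n)).

(** The rows of [C] are signed indicators of [d] disjoint nonempty sets of steps, and the rows of
    [C *m X] are the corresponding signed sums. *)
Definition signed_blocks C :=
  [/\ forall r j, C r j = 0 \/ exists e : bool, C r j = (-1) ^+ e,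
      forall r r' j, C r j != 0 -> C r' j != 0 -> r = r'
    & forall r, exists j, C r j != 0].

Definition blocks_free X := forall C, signed_blocks C -> C *m X \in unitmx.

End general_position.

(** * Flats of the arrangement inside the space of relations *)

Section flats.
Context {R : realFieldType} {n d : nat}.
Variable X : 'M[R]_(n, d).
Hypothesis Xfree : blocks_free X.
Implicit Types (alpha : 'I_n -> option (bool * 'I_n)) (z : 'rV[R]_n).

(* [alpha] encodes a flat of the arrangement: [alpha j = Some (e, r)] stands for
   z_j = (-1)^e z_r and [alpha j = None] for z_j = 0.  The roots are the free
   coordinates. *)
Definition is_root alpha (r : 'I_n) := alpha r == Some (false, r).

Definition rooted alpha := forall j e r, alpha j = Some (e, r) -> is_root alpha r.

Definition coef alpha (j r : 'I_n) : R :=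
  if alpha j is Some (e, r') then (r' == r)%:R * (-1) ^+ e else 0.

Definition obeys alpha z :=
  forall j, z 0 j = if alpha j is Some (e, r) then (-1) ^+ e * z 0 r else 0.

Definition flat alpha : set 'rV[R]_n := [set z | z *m X = 0 /\ obeys alpha z].

(** The flat cut further by the form [(a, t)]: the class of the root [a] is redirected to the target
    root with the product sign, or to zero. *)
Definition merge alpha (a : 'I_n) (t : option (bool * 'I_n)) (j : 'I_n) :=
  if alpha j is Some (delta, r) then
    if r == a then (if t is Some (e, b) then Some (delta (+) e, b) else None)
    else Some (delta, r)
  else None.

Definition target_ok alpha (a : 'I_n) (t : option (bool * 'I_n)) :=
  if t is Some (_, b) then (b != a) && is_root alpha b else true.

Section merging.
Variables (alpha : 'I_n -> option (bool * 'I_n)) (a : 'I_n) (t : option (bool * 'I_n)).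
Hypothesis alphaR : rooted alpha.
Hypothesis ra : is_root alpha a.
Hypothesis tok : target_ok alpha a t.

Lemma obeys_merge z :
  obeys (merge alpha a t) z <-> obeys alpha z /\ form_val (a, t) z = 0.
Proof.
rewrite /form_val /=; split=> [H|[H /subr0_eq H0] j].
  have E : z 0 a = if t is Some (e, b) then (-1) ^+ e * z 0 b else 0.
    by rewrite H /merge (eqP ra) eqxx; case: (t) => [[e b]|].
  split; last by rewrite E subrr.
  move=> j; rewrite H /merge; case: (alpha j) => // -[delta r].
  case: eqP => // ->; rewrite E; case: (t) => [[e b]|]; last by rewrite mulr0.
  by rewrite signr_addb mulrA.
rewrite [LHS]H /merge; case: (alpha j) => // -[delta r].
case: eqP => // ->; rewrite H0; case: (t) => [[e b]|]; last by rewrite mulr0.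
by rewrite signr_addb mulrA.
Qed.

Lemma is_root_merge r : is_root (merge alpha a t) r = is_root alpha r && (r != a).
Proof.
rewrite /is_root /merge; case E : (alpha r) => [[delta s]|//].
have rs := alphaR E; case: (eqVneq s a) => [sa|sa]; last first.
  apply/idP/andP => [/eqP[d0 sr]|[]//].
  by rewrite d0 -sr sa.
move: tok; rewrite /target_ok; case: (t) => [[e b]|] /=; last first.
  by move=> _; apply/esym/andP => -[/eqP[_ <-]]; rewrite sa eqxx.
move=> /andP[ba rb]; apply/idP/andP => [/eqP[_ br]|[/eqP[_ <-]]]; last by rewrite sa eqxx.
move: rb; rewrite /is_root br E => /eqP[_ sr].
by move: ba; rewrite br -sr sa eqxx.
Qed.

Lemma rooted_merge : rooted (merge alpha a t).
Proof.
move=> j e r; rewrite is_root_merge /merge; case E : (alpha j) => [[delta s]|//].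
have rs := alphaR E; case: (eqVneq s a) => [sa|sa]; last by case=> _ <-; rewrite rs.
by move: tok; rewrite /target_ok; case: (t) => [[e' b]|//] /andP[ba rb] [_ <-]; rewrite rb.
Qed.

Lemma card_roots_merge :
  #|[pred r | is_root alpha r]| = #|[pred r | is_root (merge alpha a t) r]|.+1.
Proof.
rewrite (cardD1 a) inE ra add1n; congr _.+1.
by apply: eq_card => r; rewrite !inE is_root_merge andbC.
Qed.

Lemma flat_merge : flat (merge alpha a t) = flat alpha `&` [set z | form_val (a, t) z = 0].
Proof.
apply/seteqP; split=> z /=; first by move=> [H /obeys_merge[]].
by move=> [[H1 H2] H3]; split=> //; apply/obeys_merge.
Qed.

End merging.

(** The classes of [d] distinct roots are disjoint nonempty signed sets of coordinates, so
    [blocks_free] applies to them. *)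
Lemma root_matrix alpha : rooted alpha ->
  (d <= #|[pred r | is_root alpha r]|)%N ->
  exists rho : 'I_d -> 'I_n, [/\ injective rho, forall r, is_root alpha (rho r) &
   (\matrix_(r, j) coef alpha j (rho r)) *m X \in unitmx].
Proof.
move=> alphaR dr.
pose rho r := enum_val (widen_ord dr r).
have rho_root r : is_root alpha (rho r) by have := enum_valP (widen_ord dr r).
have rho_inj : injective rho by move=> r s /enum_val_inj/(congr1 val)/= /val_inj.
exists rho; split=> //; apply: Xfree; split.
- move=> r j; rewrite mxE /coef; case: (alpha j) => [[e s]|]; last by left.
  by case: eqP => _; [right; exists e; rewrite mul1r|left; rewrite mul0r].
- move=> r r' j; rewrite !mxE /coef; case: (alpha j) => [[e s]|]; last by rewrite eqxx.
  case: (eqVneq s (rho r)) => [->|_]; last by rewrite mul0r eqxx.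
  by case: (eqVneq (rho r) (rho r')) => [/rho_inj//|_]; rewrite mul0r eqxx.
- move=> r; exists (rho r); rewrite mxE /coef (eqP (rho_root r)) eqxx mul1r.
  exact: oner_neq0.
Qed.

Lemma obeysB alpha y z : obeys alpha y -> obeys alpha z -> obeys alpha (y - z).
Proof.
move=> Hy Hz j; rewrite !mxE Hy Hz; case: (alpha j) => [[e r]|]; last exact: subrr.
by rewrite !mxE mulrBr.
Qed.

Lemma obeys_coef alpha a : rooted alpha -> is_root alpha a ->
  obeys alpha (\row_j coef alpha j a).
Proof.
move=> alphaR ra j; rewrite mxE /coef; case E : (alpha j) => [[e r]|//].
by rewrite mxE (eqP (alphaR _ _ _ E)) mulr1 mulrC.
Qed.

Lemma obeys_span alpha (rho : 'I_d -> 'I_n) (u : 'rV[R]_d) : rooted alpha ->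
  (forall r, is_root alpha (rho r)) ->
  obeys alpha (u *m \matrix_(r, j) coef alpha j (rho r)).
Proof.
move=> alphaR rr j; rewrite mxE; case E : (alpha j) => [[e s]|].
  rewrite mxE mulr_sumr; apply: eq_bigr => r _; rewrite !mxE /coef E.
  by rewrite (eqP (alphaR _ _ _ E)) /= mulr1; ring.
by rewrite big1// => r _; rewrite mxE /coef E mulr0.
Qed.

(** The root coordinates parametrize the vectors obeying [alpha], and [z *m X = 0] imposes [d]
    independent equations on them. *)
Lemma flat_trivial alpha z : rooted alpha -> #|[pred r | is_root alpha r]| = d ->
  flat alpha z -> z = 0.
Proof.
move=> alphaR cd [zX zo].
have [rho [rho_inj rr Cu]] := @root_matrix alpha alphaR ltac:(by rewrite cd).
set C := (\matrix_(_, _) _) in Cu.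
suff zE : z = (\row_r z 0 (rho r)) *m C.
  have : (\row_r z 0 (rho r)) *m (C *m X) = 0 by rewrite mulmxA -zE.
  move=> /(congr1 (mulmx^~ (invmx (C *m X)))); rewrite mulmxK// mul0mx => u0.
  by rewrite zE u0 mul0mx.
have rho_onto s : is_root alpha s -> exists r, rho r = s.
  move=> rs; have : s \in codom rho.
    have cE : #|codom rho| = #|[pred r | is_root alpha r]|.
      by rewrite card_codom// card_ord cd.
    rewrite (subset_cardP cE _ s) ?inE//; apply/fintype.subsetP => _ /codomP[r ->].
    by rewrite inE.
  by case/codomP => r ->; exists r.
apply/rowP => j; rewrite zo mxE; case E : (alpha j) => [[e s]|]; last first.
  by rewrite big1// => r _; rewrite !mxE /coef E mulr0.
have [r rE] := rho_onto _ (alphaR _ _ _ E).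
rewrite (bigD1 r)//= big1 ?addr0 => [|q qr].
  by rewrite !mxE /coef E rE eqxx mul1r mulrC.
by rewrite !mxE /coef E -rE (inj_eq rho_inj) eq_sym (negbTE qr) mul0r mulr0.
Qed.

Lemma flat_form_neq0 alpha a t : rooted alpha -> is_root alpha a ->
  target_ok alpha a t -> (d < #|[pred r | is_root alpha r]|)%N ->
  exists2 z, flat alpha z & form_val (a, t) z != 0.
Proof.
move=> alphaR ra tok dlt.
have alphaR' := rooted_merge alphaR tok.
have [|rho [_ rr Cu]] := @root_matrix (merge alpha a t) alphaR'.
  by rewrite -ltnS -(card_roots_merge alphaR ra tok).
set C := (\matrix_(_, _) _) in Cu.
pose v := \row_j coef alpha j a.
(* The form takes the value 1 on [v]; [z'] lies on the merged flat, where the form vanishes, and has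
   the same image under [X]. So [z' - v] is a relation with value -1. *)
pose z' := (v *m X *m invmx (C *m X)) *m C.
have /(obeys_merge t ra)[z'o z'0] : obeys (merge alpha a t) z' by exact: obeys_span.
exists (z' - v).
  split; last by apply: obeysB => //; exact: obeys_coef.
  by rewrite mulmxBl -mulmxA mulmxKV// subrr.
suff -> : form_val (a, t) (z' - v) = form_val (a, t) z' - 1.
  by rewrite z'0 sub0r oppr_eq0 oner_neq0.
move: (z') tok => w; rewrite /form_val /= !mxE.
case: (t) => [[e b]|] /= tok; last first.
  by rewrite /coef (eqP ra) eqxx mul1r; ring.
case/andP: tok => ba rb.
by rewrite !mxE /coef (eqP ra) eqxx (eqP rb) (negbTE ba) !mul0r !mul1r expr0; ring.
Qed.

Section generic_flats.
Context {k : nat}.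
Variable i : 'I_k.+1 -> nat.
Let levels := @form_levels n k i.

(** Levels are treated from the largest coordinate down, so the coordinates below [p] stay roots.
    Each cut removes one root, and the excess [e] of roots over [d] tracks the dimension of the
    flat. *)
Lemma generic_flat p alpha e : (p <= n)%N -> rooted alpha ->
  (forall a : 'I_n, (a < p)%N -> is_root alpha a) ->
  #|[pred r | is_root alpha r]| = (d + e)%N ->
  generic form_val (levels p) (flat alpha) e.
Proof.
elim: p alpha e => //= p IHp alpha e pn alphaR lowR card_root.
case: e card_root => [|e] card_root.
  move=> phi z _ /(flat_trivial alphaR); rewrite card_root addn0 => -> //.
  exact: (ev0 form_val_linear).
have tgt (phi : @form n) : phi \in form_level i p ->
    is_root alpha phi.1 /\ target_ok alpha phi.1 phi.2.
  rewrite mem_form_level => /andP[ok /eqP ap]; split; first by apply: lowR; rewrite ap.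
  move: ok; case: phi ap => a [[eps b]|//] /= ap; rewrite /form_ok /= => /and3P[ba _ _].
  by rewrite lowR ?andbT -?val_eqE /=; lia.
split.
- move=> [a t] /tgt[/= ra tok]; apply: flat_form_neq0 => //.
  by rewrite card_root addnS ltnS leq_addr.
- by apply: IHp => // [|a ap]; [exact: ltnW|apply: lowR; lia].
- move=> [a t] psi_in; have [/= ra tok] := tgt _ psi_in.
  rewrite -flat_merge//; apply: IHp; first exact: ltnW.
  + exact: rooted_merge.
  + move=> b bp; rewrite is_root_merge// lowR/=; last lia.
    move: psi_in; rewrite mem_form_level => /andP[_ /eqP/= ap].
    by rewrite -val_eqE /= ap; lia.
  + by apply: succn_inj; rewrite -card_roots_merge// card_root addnS.
Qed.

Lemma generic_kernel : (d <= n)%N ->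
  generic form_val (levels n) [set z | z *m X = 0] (n - d).
Proof.
move=> dn; pose alpha (j : 'I_n) := Some (false, j).
have root_alpha j : is_root alpha j by exact: eqxx.
have <- : flat alpha = [set z | z *m X = 0].
  apply/seteqP; split=> z /=; first by case.
  by move=> zX; split=> // j; rewrite /alpha expr0 mul1r.
apply: generic_flat => //.
rewrite subnKC// -[RHS]card_ord; apply: eq_card => j.
by rewrite inE root_alpha.
Qed.

End generic_flats.

End flats.

(** * Supporting functionals of the walk *)

Lemma perturb_pos {R : realFieldType} {J : eqType} (s : seq J) (a b : J -> R) :
  (forall j, j \in s -> 0 < a j) ->
  exists2 e, 0 < e & forall j, j \in s -> 0 < a j + e * b j.
Proof.
(* [m] exceeds every ratio [|b j| / a j], so its inverse is a small enough step. *)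
move=> a0; pose m := 1 + \sum_(j <- s) `|b j| / a j.
have sum_ge0 (t : seq J) : {subset t <= s} -> 0 <= \sum_(j <- t) `|b j| / a j.
  by move=> ts; rewrite big_seq sumr_ge0// => j /ts js; rewrite divr_ge0// ltW// a0.
have mj j : j \in s -> `|b j| < m * a j.
  move=> js; rewrite -ltr_pdivrMr ?a0// /m (big_rem j)//= addrCA ltrDl.
  by rewrite ltr_wpDr ?ltr01// sum_ge0// => x /mem_rem.
have m0 : 0 < m by rewrite ltr_wpDr ?ltr01// sum_ge0.
exists m^-1; rewrite ?invr_gt0// => j js.
have := mj j js; rewrite -ltr_pdivrMl// => H.
have : - (m^-1 * `|b j|) <= m^-1 * b j.
  by rewrite -mulrN ler_pM2l ?invr_gt0// lerNl -normrN ler_norm.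
by lra.
Qed.

(** * Gordan's alternative *)

Section gordan.
Context {R : realFieldType} {W : lmodType R} {I : eqType}.

(** Induction on the forms. A relation of an infeasible tail extends by 0. Otherwise, unless [al j0]
    is zero, a positive point [xb] of the tail has [al j0 xb < 0], and projecting along [xb] reduces
    to the tail. *)
Lemma gordan (al : I -> W -> R) (s : seq I) :
  (forall j a u v, al j (a *: u + v) = a * al j u + al j v) -> uniq s ->
  ~ (exists x, forall j, j \in s -> 0 < al j x) ->
  exists2 la : I -> R, (forall j, 0 <= la j) /\ (exists2 j, j \in s & la j != 0) &
    forall x, \sum_(j <- s) la j * al j x = 0.
Proof.
elim: s al => [|j0 s IHs] al alL; first by move=> _ []; exists 0.
move=> /= /andP[j0s us] nx.
have upd (la : I -> R) c x (be : I -> W -> R) :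
    \sum_(j <- s) (if j == j0 then c else la j) * be j x = \sum_(j <- s) la j * be j x.
  by apply: eq_big_seq => j js; rewrite ifF//; apply/negbTE; apply: contraNneq j0s => <-.
have upd_ge0 (la : I -> R) c : 0 <= c -> (forall j, 0 <= la j) ->
    forall j, 0 <= (if j == j0 then c else la j) by move=> ? ? j; case: ifP.
have upd_neq0 (la : I -> R) c : (exists2 j, j \in s & la j != 0) ->
    exists2 j, j \in j0 :: s & (if j == j0 then c else la j) != 0.
  move=> [j js lj]; exists j; rewrite ?inE ?js ?orbT//.
  by rewrite ifF//; apply/negbTE; apply: contraNneq j0s => <-.
have [[xb xbP]|nxs] := pselect (exists x, forall j, j \in s -> 0 < al j x); last first.
  have [la [la0 lan] laS] := IHs _ alL us nxs.
  exists (fun j => if j == j0 then 0 else la j); first by split; [exact: upd_ge0|exact: upd_neq0].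
  by move=> x; rewrite big_cons eqxx mul0r add0r upd.
have [b0|] := pselect (forall y, al j0 y = 0).
  exists (fun j => if j == j0 then 1 else 0).
    split; first by move=> j; case: ifP.
    by exists j0; rewrite ?mem_head// eqxx oner_neq0.
  move=> x; rewrite big_cons eqxx mul1r b0 add0r big_seq big1// => j js.
  by rewrite ifF ?mul0r//; apply/negbTE; apply: contraNneq j0s => <-.
move=> /existsNP[y /eqP y0].
have al0 j : al j 0 = 0 by have := alL j 1 0 0; rewrite scaler0 addr0 mul1r; lra.
have alZ j a u : al j (a *: u) = a * al j u by rewrite -[_ *: u]addr0 alL al0 addr0.
wlog {y0} yp : y / 0 < al j0 y.
  move=> wl; have [|yn|/eqP] := ltrgt0P (al j0 y); last by rewrite (negbTE y0).
    exact: wl.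
  by apply: (wl ((-1) *: y)); rewrite alZ; lra.
(* A positive point of the tail on the kernel of [al j0], moved slightly towards [y], would solve
   the whole system. *)
have noz x : al j0 x = 0 -> ~ (forall j, j \in s -> 0 < al j x).
  move=> x0 xP; apply: nx.
  have [e e0 He] := @perturb_pos R I s (al ^~ x) (al ^~ y) xP.
  exists (e *: y + x) => j; rewrite alL inE => /orP[/eqP->|js].
    by rewrite x0 addr0 mulr_gt0.
  by rewrite addrC; exact: He.
have xbn : al j0 xb < 0.
  have [xbp|//|xb0] := ltrgt0P (al j0 xb); last by case: (noz xb xb0).
  by case: nx; exists xb => j; rewrite inE => /orP[/eqP->//|/xbP].
(* [be j] is [al j] after projection along [xb] onto the kernel of [al j0]. *)
pose be j x := al j x - al j xb / al j0 xb * al j0 x.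
have beL j a u v : be j (a *: u + v) = a * be j u + be j v by rewrite /be !alL; ring.
have [|la [la0 lan] laS] := IHs be beL us.
  move=> [x xP]; apply: (noz ((- (al j0 x / al j0 xb)) *: xb + x)).
    by rewrite alL; field; lra.
  by move=> j js; rewrite alL; have := xP j js; rewrite /be; congr (_ < _); ring.
(* The multiplier of [j0] collects the correction terms of the [be j]; it is nonnegative because
   [al j xb > 0 > al j0 xb]. *)
exists (fun j => if j == j0 then - (\sum_(j <- s) la j * (al j xb / al j0 xb)) else la j).
  split; last exact: upd_neq0.
  apply: upd_ge0 => //; rewrite oppr_ge0 big_seq sumr_le0// => j js.
  apply: mulr_ge0_le0 => //; apply: mulr_ge0_le0; first exact/ltW/xbP.
  by rewrite invr_le0 ltW.
move=> x; rewrite big_cons eqxx upd; apply/eqP; rewrite -[X in _ == X](laS x); apply/eqP.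
rewrite mulNr mulr_suml -sumrN -big_split /=; apply: eq_bigr => j _.
by rewrite /be; ring.
Qed.

End gordan.

Lemma kermx_orth {F : fieldType} {n d : nat} (X : 'M[F]_(n, d)) (v : 'cV[F]_n) :
  kermx X *m v = 0 -> exists f, v = X *m f.
Proof.
move=> Kv; suff /submxP[D vD] : (v^T <= X^T)%MS.
  by exists D^T; rewrite -[v]trmxK vD trmx_mul trmxK.
rewrite submxE -trmx_eq0 trmx_mul trmxK.
have /submxP[D ->] : ((cokermx X^T)^T <= kermx X)%MS.
  by apply/sub_kermxP; rewrite -[X in _ *m X]trmxK -trmx_mul mulmx_coker trmx0.
by rewrite -mulmxA Kv mulmx0.
Qed.

Lemma ex_subset_card {T : finType} (A : {set T}) m : (m <= #|A|)%N ->
  exists2 B : {set T}, B \subset A & #|B| = m.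
Proof.
move=> mA; exists [set x in take m (enum A)]%SET.
  by apply/fintype.subsetP => x; rewrite inE => /mem_take; rewrite mem_enum.
rewrite cardsE; have /card_uniqP -> : uniq (take m (enum A)) by rewrite take_uniq// enum_uniq.
by rewrite size_takel// -cardE.
Qed.

Lemma ex_superset_card {T : finType} (A : {set T}) m : (#|A| <= m <= #|T|)%N ->
  exists2 B : {set T}, A \subset B & #|B| = m.
Proof.
move=> /andP[Am mT]; have [|B BA cB] := @ex_subset_card _ (~: A)%SET (m - #|A|).
  by rewrite -(cardsC A) in mT; lia.
exists (A :|: B)%SET; first exact: finset.subsetUl.
rewrite cardsU cB (_ : A :&: B = finset.set0)%SET ?cards0; first lia.
by apply/eqP; rewrite setI_eq0 disjoint_sym finset.disjoints_subset.
Qed.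

(** * Partial sums and strictly supporting hyperplanes *)

Section walk.
Context {R : realFieldType} {n d : nat}.
Variable X : 'M[R]_(n, d).

Definition walk (p : nat) : 'rV[R]_d := \sum_(j < n | (j < p)%N) row j X.

Lemma walk0 : walk 0 = 0.
Proof. by rewrite /walk big_pred0. Qed.

Lemma walkS (j : 'I_n) : walk j.+1 = walk j + row j X.
Proof.
rewrite /walk (bigD1 j)//= addrC; congr (_ + _); apply: eq_bigl => m.
by rewrite -val_eqE /=; lia.
Qed.

Hypothesis Xfree : blocks_free X.

(** Increments over consecutive intervals are sums over disjoint sets of steps. Invertibility says
    that the [d + 1] points of the walk at the times [tau] are affinely independent. *)
Lemma walk_blocks (tau : nat -> nat) :
  (forall r s, (r < s <= d)%N -> (tau r < tau s)%N) -> (tau d <= n)%N ->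
  \matrix_(r < d) (walk (tau r.+1) - walk (tau r)) \in unitmx.
Proof.
move=> tau_lt taun.
have tau_le r s : (r <= s <= d)%N -> (tau r <= tau s)%N.
  by case/andP; rewrite leq_eqVlt => /orP[/eqP->//|rs sd]; apply/ltnW/tau_lt; rewrite rs.
pose C : 'M[R]_(d, n) := \matrix_(r, j) (tau r <= j < tau r.+1)%N%:R.
have -> : \matrix_(r < d) (walk (tau r.+1) - walk (tau r)) = C *m X.
  apply/row_matrixP => r; rewrite rowK row_mul mulmx_sum_row /walk.
  rewrite [X in _ = X](eq_bigr (fun j : 'I_n =>
    (tau r <= j < tau r.+1)%N%:R *: row j X)); last first.
    by move=> j _; rewrite !mxE.
  rewrite big_mkcond [X in _ - X]big_mkcond -sumrB; apply: eq_bigr => j _.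
  have := tau_lt r r.+1; rewrite ltnSn ltn_ord => /(_ isT) rr.
  case: (ltnP j (tau r)) => jr /=.
    by rewrite ifT; [rewrite subrr scale0r|lia].
  by rewrite subr0; case: ltnP => _; rewrite ?scale1r ?scale0r.
apply: Xfree; split.
- by move=> r j; rewrite mxE; case: (_ <= _ < _)%N; [right; exists false|left].
- move=> r s j; rewrite !mxE; case: (boolP (_ <= _ < _)%N) => /= [rj _|]; last by rewrite eqxx.
  case: (boolP (_ <= _ < _)%N) => /= [sj _|]; last by rewrite eqxx.
  apply: val_inj => /=; case: (ltngtP r s) => // lt.
    by have := tau_le r.+1 s; rewrite lt ltnW// => /(_ isT); lia.
  by have := tau_le s.+1 r; rewrite lt ltnW// => /(_ isT); lia.
- move=> r; have := tau_lt r r.+1; rewrite ltnSn ltn_ord => /(_ isT) rr.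
  have jn : (tau r < n)%N.
    by apply: (leq_trans rr); apply: leq_trans taun; apply: tau_le; rewrite ltn_ord /=.
  by exists (Ordinal jn); rewrite mxE /= leqnn rr oner_neq0.
Qed.

Lemma enum_increasing (J : {set 'I_n.+1}) : #|J| = d.+1 ->
  exists tau : nat -> nat, [/\ forall r s, (r < s <= d)%N -> (tau r < tau s)%N,
    (tau d <= n)%N, forall r, (r <= d)%N -> exists2 p, p \in J & p = tau r :> nat
   & forall p, p \in J -> exists2 r, (r <= d)%N & p = tau r :> nat].
Proof.
move=> cJ; pose tau r := nth 0%N (map val (enum J)) r.
have szE : size (map val (enum J)) = d.+1 by rewrite size_map -cardE.
have srt : sorted ltn (map val (enum J)).
  apply: (subseq_sorted ltn_trans _ (iota_ltn_sorted 0 n.+1)).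
  rewrite -val_enum_ord; apply: map_subseq; rewrite enumT.
  by rewrite {1}/enum_mem; exact: filter_subseq.
have tauJ r : (r <= d)%N -> exists2 p, p \in J & p = tau r :> nat.
  move=> rd; have : tau r \in map val (enum J) by rewrite mem_nth ?szE.
  by case/mapP => p; rewrite mem_enum => pJ ->; exists p.
exists tau; split=> //.
- move=> r s /andP[rs sd]; apply: (sorted_ltn_nth ltn_trans) => //.
    by rewrite inE szE; lia.
  by rewrite inE szE ltnS.
- by have [p _ <-] := tauJ d (leqnn _); rewrite -ltnS.
- move=> p pJ; have pin : val p \in map val (enum J) by rewrite map_f ?mem_enum.
  exists (index (val p) (map val (enum J))).
    by rewrite -ltnS -szE index_mem.
  by rewrite /tau nth_index.
Qed.

(** An affine function takes any values at [d + 1] affinely independent points; [c] is its constant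
    term. *)
Lemma walk_prescribed (J : {set 'I_n.+1}) (h : nat -> R) : #|J| = d.+1 ->
  exists (g : 'cV[R]_d) (c : R), forall p, p \in J -> (walk p *m g) 0 0 = h p + c.
Proof.
move=> /enum_increasing[tau [tau_lt taun _ tauJ]].
have U := walk_blocks tau_lt taun; set B := (\matrix_(r < d) _) in U.
pose g := invmx B *m \col_(r < d) (h (tau r.+1) - h (tau r)).
exists g, ((walk (tau 0) *m g) 0 0 - h (tau 0%N)) => p /tauJ[r rd ->].
elim: r rd => [|r IHr] rd; first by ring.
have : (B *m g) (Ordinal rd) 0 = h (tau r.+1) - h (tau r) by rewrite /g mulKVmx// mxE.
have -> : (B *m g) (Ordinal rd) 0 = (row (Ordinal rd) B *m g) 0 0 by rewrite -row_mul [RHS]mxE.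
by rewrite rowK mulmxBl !mxE; have := IHr (ltnW rd); rewrite !mxE; lra.
Qed.

Lemma walk_constant (J : {set 'I_n.+1}) (g : 'cV[R]_d) (c : R) : #|J| = d.+1 ->
  (forall p, p \in J -> (walk p *m g) 0 0 = c) -> g = 0.
Proof.
move=> /enum_increasing[tau [tau_lt taun tauJ _]] H.
have U := walk_blocks tau_lt taun; set B := (\matrix_(r < d) _) in U.
have Bg : B *m g = 0.
  apply/colP => r; rewrite [RHS]mxE.
  have -> : (B *m g) r 0 = (row r B *m g) 0 0 by rewrite -row_mul [RHS]mxE.
  rewrite rowK mulmxBl mxE [X in _ + X]mxE.
  have [p pJ <-] := tauJ r.+1 (ltn_ord r); have [q qJ <-] := tauJ r (ltnW (ltn_ord r)).
  by rewrite !H// subrr.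
by rewrite -[g](mulKmx U) Bg mulmx0.
Qed.

Section support.
Context {k : nat}.
Variable i : 'I_k.+1 -> nat.
Hypothesis i_incr : forall a b : 'I_k.+1, (a < b)%N -> (i a < i b)%N.
Hypothesis i_le_n : forall a : 'I_k.+1, (i a <= n)%N.
Hypothesis dn : (d <= n)%N.
Hypothesis kd : (k < d)%N.

Definition strict_support := exists (f : 'cV[R]_d) (c : R), forall p, (p <= n)%N ->
  if vertex i p then (walk p *m f) 0 0 = c else (walk p *m f) 0 0 < c.

(** A nonconstant [f] touches the walk in at most [d] points, as [d + 1] would force [f = 0]. On a
    set of [d + 1] points containing these, prescribe a second functional with value 0 at vertices
    and -1 elsewhere, up to a constant, and add a small multiple of it. *)
Lemma strict_supportW (f : 'cV[R]_d) (c : R) :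
  (forall p, (p <= n)%N -> (walk p *m f) 0 0 <= c) ->
  (forall p, vertex i p -> (walk p *m f) 0 0 = c) ->
  (exists2 p, (p <= n)%N & (walk p *m f) 0 0 <> c) -> strict_support.
Proof.
move=> fle fv [p0 p0n fp0]; pose J := [set p : 'I_n.+1 | (walk p *m f) 0 0 == c]%SET.
have [dJ|Jd] := ltnP d #|J|.
  have [B BJ cB] := @ex_subset_card _ J d.+1 dJ.
  have f0 : f = 0.
    by apply: (@walk_constant B f c) => // p /(fintype.subsetP BJ); rewrite inE => /eqP.
  have /card_gt0P[p] : (0 < #|J|)%N by lia.
  by rewrite inE f0 mulmx0 mxE => /eqP c0; case: fp0; rewrite f0 mulmx0 mxE.
have [|B JB cB] := @ex_superset_card _ J d.+1; first by rewrite card_ord; lia.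
have [g [c' gP]] := walk_prescribed (fun p => if vertex i p then 0 else -1) cB.
pose s := [seq p <- enum 'I_n.+1 | p \notin J].
have [e e0 He] := @perturb_pos R _ s (fun p : 'I_n.+1 => c - (walk p *m f) 0 0)
  (fun p : 'I_n.+1 => c' - (walk p *m g) 0 0)
  (fun p => ltac:(rewrite mem_filter inE subr_gt0 lt_neqAle => /andP[-> _];
      exact: (fle p (ltn_ord p)))).
exists (f + e *: g), (c + e * c') => p pn.
have -> : (walk p *m (f + e *: g)) 0 0 = (walk p *m f) 0 0 + e * (walk p *m g) 0 0.
  by rewrite mulmxDr -scalemxAr mxE [X in _ + X]mxE.
have [pJ|pJ] := boolP (Ordinal (pn : (p < n.+1)%N) \in J).
  have := gP _ (fintype.subsetP JB _ pJ) => /= ->.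
  by move: pJ; rewrite inE => /= /eqP ->; case: (vertex i p); lra.
have := He (Ordinal (pn : (p < n.+1)%N)); rewrite mem_filter pJ mem_enum => /(_ isT) /= {}He.
by rewrite ifF; [lra|apply: contraNF pJ => /fv pv; rewrite inE /= pv].
Qed.

(** Summation by parts; the padding zeros kill both boundary terms, so [c] is free. *)
Lemma padding_sum (y : 'rV[R]_n) (F : nat -> R) (c : R) :
  \sum_(p < n.+1) (c - F p) * (pad y p.+1 - pad y p) =
  \sum_(j < n) y 0 j * (F j.+1 - F j).
Proof.
have H m : \sum_(p < m) (c - F p) * (pad y p.+1 - pad y p) =
    (c - F m) * pad y m + \sum_(p < m) pad y p.+1 * (F p.+1 - F p).
  elim: m => [|m IHm]; first by rewrite !big_ord0 /= mulr0 addr0.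
  by rewrite !big_ord_recr /= IHm; ring.
rewrite H big_ord_recr /= -/(pad y n.+1) pad_last mulr0 mul0r addr0 add0r.
by apply: eq_bigr => j _; rewrite -padS.
Qed.

Lemma pad_linear a (y z : 'rV[R]_n) p : pad (a *: y + z) p = a * pad y p + pad z p.
Proof.
case: p => [|p] /=; first by rewrite mulr0 addr0.
by case: insub => [j|]; [rewrite !mxE|rewrite mulr0 addr0].
Qed.

Lemma ex_nonvertex : exists p : 'I_n.+1, ~~ vertex i p.
Proof.
have [p pv|H] := pickP (fun p : 'I_n.+1 => ~~ vertex i p); first by exists p.
suff : (#|'I_n.+1| <= #|'I_k.+1|)%N by rewrite !card_ord; lia.
apply: leq_trans (max_card (fun=> true)).
apply: (leq_trans _ (leq_image_card (fun l => inord (i l) : 'I_n.+1) xpredT)).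
apply: subset_leq_card; apply/fintype.subsetP => p _.
have /negbFE/existsP[l /eqP lp] := H p.
by apply/fintype.imageP; exists l; rewrite ?lp ?inord_val.
Qed.

Lemma row_pairing (y : 'rV[R]_n) (f : 'cV[R]_d) (c : R) :
  (y *m X *m f) 0 0 =
  \sum_(p < n.+1) (c - (walk p *m f) 0 0) * (pad y p.+1 - pad y p).
Proof.
rewrite (padding_sum y (fun p => (walk p *m f) 0 0) c) -mulmxA mxE.
apply: eq_bigr => j _; congr (_ * _).
rewrite walkS mulmxDl -row_mul [X in _ = X - _]mxE [row _ _ _ _]mxE; ring.
Qed.

(** A supporting functional and a relation in the base chamber would give a vanishing sum of
    nonnegative terms with a positive one. Conversely, Gordan's multipliers for the increments on
    the relation space are the defects of a weakly supporting functional. *)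
Lemma strict_supportP :
  strict_support <-> ~ exists2 y : 'rV[R]_n, base_chamber i y & y *m X = 0.
Proof.
split=> [[f [c fP]] [y yB yX]|ny].
  have := row_pairing y f c; rewrite yX mul0mx mxE => /esym/eqP.
  rewrite psumr_eq0 => [/allP H|p _]; last first.
    have := fP p (ltn_ord p); case: ifP => [_ ->|pv fpc]; first by rewrite subrr mul0r.
    by rewrite mulr_ge0// subr_ge0 ltW// yB ?pv// -ltnS.
  have [p pv] := ex_nonvertex.
  have := H p (mem_index_enum _); have := fP p (ltn_ord p); rewrite (negbTE pv) => fpc.
  by rewrite mulf_eq0 !subr_eq0 !gt_eqF// yB// -ltnS.
pose al (p : 'I_n.+1) (u : 'rV[R]_n) := pad (u *m kermx X) p.+1 - pad (u *m kermx X) p.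
have alL p a u v : al p (a *: u + v) = a * al p u + al p v.
  by rewrite /al mulmxDl -scalemxAl !pad_linear; ring.
pose s := [seq p : 'I_n.+1 <- enum 'I_n.+1 | ~~ vertex i p].
have [||la [la0 [p0 p0s lp0]] laS] := @gordan R _ _ al s alL.
- by rewrite filter_uniq// enum_uniq.
- move=> [u uP]; apply: ny; exists (u *m kermx X); last by rewrite -mulmxA mulmx_ker mulmx0.
  move=> p pn pv; have := uP (Ordinal (pn : (p < n.+1)%N)).
  by rewrite mem_filter /= pv mem_enum => /(_ isT); rewrite /al subr_gt0.
(* [mu p] will be the defect c - f(S_p), hence 0 at vertices. *)
pose mu (p : nat) := if vertex i p then 0 else la (inord p).
have muE (p : 'I_n.+1) : mu p = if vertex i p then 0 else la p by rewrite /mu inord_val.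
(* By Gordan's relation the differences of [mu] annihilate all relations between the steps, so they
   are the values of a functional on the steps. *)
have [|f fE] := @kermx_orth R n d X (\col_j (mu j - mu j.+1)).
  suff H (u : 'rV[R]_n) : u *m (kermx X *m \col_j (mu j - mu j.+1)) = 0.
    by apply/row_matrixP => r; rewrite rowE H row0.
  apply/rowP => z; rewrite ord1 [RHS]mxE mulmxA mxE -[RHS](laS u) /s big_filter big_enum_cond.
  rewrite [RHS]big_mkcond.
  transitivity (\sum_(j < n) (u *m kermx X) 0 j * (- mu j.+1 - - mu j)).
    by apply: eq_bigr => j _; rewrite [X in _ * X]mxE opprK addrC.
  rewrite -[LHS](padding_sum _ (fun p => - mu p) 0); apply: eq_bigr => p _.
  by rewrite sub0r opprK muE; case: ifP; rewrite ?mul0r.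
have fw p : (p <= n)%N -> (walk p *m f) 0 0 = mu 0%N - mu p.
  elim: p => [|p IHp] pn; first by rewrite walk0 mul0mx mxE subrr.
  rewrite -[p]/(val (Ordinal pn)) walkS mulmxDl mxE IHp ?(ltnW pn)//=.
  by rewrite -row_mul -fE !mxE /=; ring.
apply: (@strict_supportW f (mu 0%N)).
- move=> p pn; rewrite fw// lerBlDr lerDl /mu; by case: ifP.
- move=> p pv; have /existsP[l /eqP lp] := pv.
  by rewrite fw -?lp// lp {2}/mu pv subr0.
- move: p0s; rewrite mem_filter => /andP[p0v _]; exists (val p0); first by rewrite -ltnS ltn_ord.
  rewrite fw; last by rewrite -ltnS ltn_ord.
  by rewrite muE (negbTE p0v); move/eqP: lp0; lra.
Qed.

End support.
End walk.

(** * Faces of convex hulls *)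

Section hulls.
Context {R : realType} {V : vectType R}.
Implicit Types (A S F : set V).

Lemma convex_setP A : @convex_set R V A <->
  forall x y t, A x -> A y -> 0 <= t <= 1 -> A (t *: x + (1 - t) *: y).
Proof.
split=> [cA x y t Ax Ay /andP[t0 t1]|cA x y t /set_mem Ax /set_mem Ay]; last first.
  by apply/mem_set; apply: cA => //; rewrite ge0 le1.
pose t01 : {i01 R} := Itv01 t0 t1.
by have /set_mem := cA x y t01 (mem_set Ax) (mem_set Ay).
Qed.

Lemma convex_hull_convex S : @convex_set R V (convex_hull S).
Proof.
apply/convex_setP => x y t Sx Sy t01 A [cA SA].
by move/convex_setP : (cA); apply => //; [exact: Sx|exact: Sy].
Qed.

Lemma sub_convex_hull S : S `<=` convex_hull S.
Proof. exact: sub_gen_smallest. Qed.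

Lemma convex_hull_min S A : @convex_set R V A -> S `<=` A -> convex_hull S `<=` A.
Proof. exact: smallest_sub. Qed.

Lemma convex_combination A {I : eqType} (s : seq I) (q : I -> V) (la : I -> R) :
  @convex_set R V A -> (forall j, j \in s -> A (q j)) -> (forall j, 0 <= la j) ->
  0 < \sum_(j <- s) la j ->
  A ((\sum_(j <- s) la j)^-1 *: \sum_(j <- s) la j *: q j).
Proof.
move=> /convex_setP cA + la0; elim: s => [|j s IHs] Aq; first by rewrite big_nil ltxx.
rewrite !big_cons; set L := \sum_(j <- s) la j; set v := \sum_(j <- s) _ => L0.
have Aj : A (q j) by apply: Aq; rewrite mem_head.
have {}Aq m : m \in s -> A (q m) by move=> ms; apply: Aq; rewrite inE ms orbT.
have := sumr_ge0 s (fun m (_ : true) => la0 m); rewrite -/L le_eqVlt => /orP[/eqP L00|Lp].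
  have -> : v = 0.
    rewrite /v big_seq big1// => m ms.
    have /eqP := esym L00; rewrite psumr_eq0 => [/allP/(_ m ms)/eqP->|//].
    exact: scale0r.
  rewrite -L00 addr0 in L0 *; rewrite addr0 scalerA mulVf ?scale1r//; lra.
have -> : (la j + L)^-1 *: (la j *: q j + v) =
    (la j / (la j + L)) *: q j + (1 - la j / (la j + L)) *: (L^-1 *: v).
  rewrite scalerDr !scalerA; congr (_ *: _ + _ *: _); first by rewrite mulrC.
  by field; lra.
apply: cA => //; first exact: IHs.
by apply/andP; split; [rewrite divr_ge0// ltW|rewrite ler_pdivrMr// mul1r lerDl ltW].
Qed.

Lemma convex_hull_range {I : finType} (q : I -> V) :
  convex_hull (range q) = [set x | exists la : I -> R,
     [/\ forall j, 0 <= la j, \sum_j la j = 1 & x = \sum_j la j *: q j]].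
Proof.
apply/seteqP; split=> [|x [la [la0 la1 ->]]]; last first.
  have := @convex_combination (convex_hull (range q)) I (index_enum I) q la
    (@convex_hull_convex _).
  rewrite la1 invr1 scale1r ltr01; apply => // j _; apply: sub_convex_hull.
  by exists j.
apply: convex_hull_min.
  apply/convex_setP => x y t [la [la0 la1 ->]] [mu [mu0 mu1 ->]] /andP[t0 t1].
  exists (fun j => t * la j + (1 - t) * mu j); split.
  - by move=> j; rewrite addr_ge0// mulr_ge0// subr_ge0.
  - by rewrite big_split/= -!mulr_sumr la1 mu1; ring.
  - rewrite !scaler_sumr -big_split/=; apply: eq_bigr => j _.
    by rewrite !scalerA -scalerDl.
move=> _ [j _ <-]; exists (fun m => (m == j)%:R); split=> //.
  by rewrite (bigD1 j)//= eqxx big1 ?addr0// => m /negbTE ->.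
rewrite (bigD1 j)//= eqxx scale1r big1 ?addr0// => m /negbTE ->.
exact: scale0r.
Qed.

Lemma is_face_hull S F : F `<=` S ->
  is_face (convex_hull S) (convex_hull F) <->
  exists (f : {linear V -> R^o}) (c : R), [/\ forall x, S x -> f x <= c,
    forall x, F x -> f x = c & forall x, S x -> f x = c -> convex_hull F x].
Proof.
move=> FS; split=> [[f [c [fle FE]]]|[f [c [Sle Fc SF]]]]; exists f, c.
  split=> [x Sx|x Fx|x Sx fx].
  - by apply: fle; exact: sub_convex_hull.
  - by have := @sub_convex_hull F x Fx; rewrite FE => -[].
  - by rewrite FE; split=> //; exact: sub_convex_hull.
have fconv x y t : f (t *: x + (1 - t) *: y) = t * f x + (1 - t) * f y.
  by rewrite linearD !linearZ.
have hF x : convex_hull F x -> f x = c.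
  apply: (@convex_hull_min F [set x | f x = c]) => //.
  by apply/convex_setP => {}x y t /= fx fy _; rewrite fconv fx fy; ring.
(* This set is convex because [f = c] on the hull of [F]: a proper mixture with a point of smaller
   value stays below [c]. *)
have hle : convex_hull S `<=` [set x | f x < c \/ convex_hull F x].
  apply: convex_hull_min.
    apply/convex_setP => x y t xP yP /andP[t0 t1].
    have [->|tn0] := eqVneq t 0; first by rewrite scale0r add0r subr0 scale1r.
    have [->|tn1] := eqVneq t 1; first by rewrite subrr scale0r addr0 scale1r.
    have {tn0 t0}t0 : 0 < t by rewrite lt_neqAle eq_sym tn0.
    have {tn1 t1}t1 : t < 1 by rewrite lt_neqAle tn1.
    rewrite /= fconv; move: xP yP => /= [xc|Fx] [yc|Fy].
    - by left; nra.
    - by left; rewrite (hF y)//; nra.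
    - by left; rewrite (hF x)//; nra.
    - right; have /convex_setP := @convex_hull_convex F; apply => //.
      by rewrite !ltW.
  move=> x Sx; have := Sle x Sx; rewrite le_eqVlt => /orP[/eqP/(SF x Sx)|]; [right|left]=> //.
split; first by move=> x /hle[/ltW//|/hF->].
apply/seteqP; split=> [x Fx|x [Sx fx]].
  split; last exact: hF.
  by apply: (convex_hull_min (@convex_hull_convex S) _ Fx) => y /FS; exact: sub_convex_hull.
by have [|//] := hle _ Sx; rewrite fx ltxx.
Qed.

Definition affinely_free {k : nat} (q : 'I_k.+1 -> V) :=
  forall mu : 'I_k.+1 -> R, \sum_a mu a = 0 -> \sum_a mu a *: q a = 0 ->
    forall a, mu a = 0.

(** The affine hull is [q ord0] plus the span of the [k] differences, and a coset determines its
    direction space; dimension [k] thus means that these differences are free. *)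
Lemma has_dim_hull {k : nat} (q : 'I_k.+1 -> V) :
  has_dim k (convex_hull (range q)) <-> affinely_free q.
Proof.
pose T : k.-tuple V := [tuple q (lift ord0 a) - q ord0 | a < k].
have TE (a : 'I_k) x0 : nth x0 T a = q (lift ord0 a) - q ord0.
  by rewrite -tnth_nth tnth_mktuple.
pose U := <<T>>%VS.
have qU a : q a - q ord0 \in U.
  have [b ->|->] := unliftP ord0 a; last by rewrite subrr mem0v.
  by rewrite -(TE b 0) memv_span// mem_nth// size_tuple.
have hU : affine_hull (convex_hull (range q)) = [set q ord0 + u | u in [set` U]].
  apply/seteqP; split=> [x [m [y [c [yq c1 ->]]]]|_ [u uU <-]].
    exists (\sum_(r < m) c r *: (y r - q ord0)).
      apply: memv_suml => r _; apply: memvZ; have := yq r.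
      rewrite convex_hull_range => -[la [_ la1 ->]].
      rewrite -[q ord0]scale1r -la1 scaler_suml -sumrB.
      by apply: memv_suml => a _; rewrite -scalerBr memvZ.
    under eq_bigr do rewrite scalerBr; rewrite sumrB -scaler_suml c1 scale1r.
    by rewrite addrC subrK.
  exists k.+1, q, (fun a => if unlift ord0 a is Some b then coord T b u
    else 1 - \sum_b coord T b u); split.
  - by move=> r; apply: sub_convex_hull; exists r.
  - rewrite big_ord_recl unlift_none; under [X in _ + X]eq_bigr do rewrite liftK.
    exact: subrK.
  - rewrite [RHS]big_ord_recl unlift_none; under [X in _ = _ + X]eq_bigr do rewrite liftK.
    rewrite {1}(coord_span uU). under [X in _ + X = _]eq_bigr do rewrite TE scalerBr.
    by rewrite sumrB -scaler_suml scalerBl scale1r addrCA addrC.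
have -> : has_dim k (convex_hull (range q)) <-> \dim U = k.
  split=> [[x [W [dW E]]]|dU]; last by exists (q ord0), U.
  rewrite -[RHS]dW.
  have shift y : (exists2 w, w \in W & x + w = y) <-> (exists2 u, u \in U & q ord0 + u = y).
    by have : [set x + w | w in [set` W]] y <-> [set q ord0 + u | u in [set` U]] y
      by rewrite -E hU.
  have [|u0 u0U xE] := (shift x).1; first by exists 0; rewrite ?mem0v ?addr0.
  congr (\dim _); apply/eqP; rewrite eqEsubv; apply/andP; split; apply/subvP => v.
    move=> vU; have [|w wW /addrI<-//] := (shift (x + v)).2.
    by exists (u0 + v); [exact: memvD|rewrite addrA xE].
  move=> vW; have [|u uU uE] := (shift (x + v)).1; first by exists v.
  suff -> : v = u - u0 by rewrite memvB.
  by apply: (addrI x); rewrite -uE -xE; apply/esym; rewrite addrACA subrr addr0.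
have -> : \dim U = k <-> free T.
  by rewrite /free -/U size_tuple; split=> [->|/eqP].
split=> [/freeP Tf mu mu0 muq|qf].
  have mu_lift (b : 'I_k) : mu (lift ord0 b) = 0.
    apply: (Tf (fun b => mu (lift ord0 b))); under eq_bigr do rewrite TE scalerBr.
    rewrite sumrB -scaler_suml; move: mu0 muq; rewrite !big_ord_recl => /eqP.
    by rewrite addrC addr_eq0 => /eqP -> /eqP; rewrite scaleNr opprK addrC => /eqP.
  move=> a; have [b ->|->] := unliftP ord0 a; first exact: mu_lift.
  by move: mu0; rewrite big_ord_recl big1 ?addr0.
apply/freeP => la la0 b.
pose g (a : 'I_k.+1) := if unlift ord0 a is Some b then la b else - \sum_b la b.
have gL c : g (lift ord0 c) = la c by rewrite /g liftK.
have g0 : g ord0 = - \sum_b la b by rewrite /g unlift_none.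
rewrite -gL; apply: qf; rewrite big_ord_recl g0; under [X in _ + X = _]eq_bigr do rewrite gL.
  exact: addNr.
rewrite -[RHS]la0; under [RHS]eq_bigr do rewrite TE scalerBr.
by rewrite sumrB -scaler_suml scaleNr addrC.
Qed.

End hulls.

Section linear_forms.
Context {R : realType} {d : nat}.

Definition pairing (g : 'cV[R]_d) (x : 'rV[R]_d) : R^o := (x *m g) 0 0.

Lemma pairing_linear g : linear (pairing g).
Proof. by move=> a x y; rewrite /pairing mulmxDl -scalemxAl !mxE. Qed.

HB.instance Definition _ g :=
  GRing.isLinear.Build R 'rV[R]_d R^o *:%R (pairing g) (pairing_linear g).

Lemma linear_pairing (f : {linear 'rV[R]_d -> R^o}) :
  exists g : 'cV[R]_d, forall x, f x = (x *m g) 0 0.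
Proof.
exists (\col_j f (delta_mx 0 j)) => x.
rewrite {1}(row_sum_delta x) linear_sum mxE; apply: eq_bigr => j _.
by rewrite linearZ mxE.
Qed.

End linear_forms.

(** * Faces of the hull of the walk *)

Section walk_faces.
Context {R : realType} {n d k : nat}.
Variable i : 'I_k.+1 -> nat.
Hypothesis i_incr : forall a b : 'I_k.+1, (a < b)%N -> (i a < i b)%N.
Hypothesis i_le_n : forall a : 'I_k.+1, (i a <= n)%N.
Implicit Types X : 'M[R]_(n, d).

Definition walk_vertices X (a : 'I_k.+1) : 'rV[R]_d := walk X (i a).

Definition walk_face X := faces k (convex_hull [set walk X p | p in [set p | (p <= n)%N]])
  (convex_hull (range (walk_vertices X))).

Lemma walk_faceE X : walk_face X <-> affinely_free (walk_vertices X) /\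
  exists (g : 'cV[R]_d) (c : R), [/\ forall p, (p <= n)%N -> (walk X p *m g) 0 0 <= c,
    forall p, vertex i p -> (walk X p *m g) 0 0 = c
  & forall p, (p <= n)%N -> (walk X p *m g) 0 0 = c ->
      convex_hull (range (walk_vertices X)) (walk X p)].
Proof.
have FS : range (walk_vertices X) `<=` [set walk X p | p in [set p | (p <= n)%N]].
  by move=> _ [a _ <-]; exists (i a); rewrite //= i_le_n.
split=> [[/(is_face_hull FS)[f [c [fle fc ft]]] /has_dim_hull//]|[/has_dim_hull aff]].
  split=> //; have [g gE] := linear_pairing f; exists g, c; split.
  - by move=> p pn; rewrite -gE; apply: fle; exists p.
  - by move=> p /existsP[l /eqP <-]; rewrite -gE; apply: fc; exists l.
  - by move=> p pn gp; apply: ft; [exists p|rewrite gE].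
move=> [g [c [gle gc gt]]]; split=> //; apply/(is_face_hull FS).
exists (pairing g), c; split.
- by move=> _ [p pn <-]; exact: gle.
- by move=> _ [a _ <-]; apply: gc; apply/existsP; exists a.
- by move=> _ [p pn <-]; exact: gt.
Qed.

Lemma card_vertices : (#|[set p : 'I_n.+1 | vertex i p]%SET| <= k.+1)%N.
Proof.
rewrite -[X in (_ <= X)%N]card_ord.
apply: (leq_trans _ (leq_imset_card (fun l => inord (i l) : 'I_n.+1) predT)).
apply/subset_leq_card/fintype.subsetP => p; rewrite inE => /existsP[l /eqP lp].
by apply/imsetP; exists l; rewrite ?lp ?inord_val.
Qed.

Section free_blocks.
Variable X : 'M[R]_(n, d).
Hypotheses (Xfree : blocks_free X) (dn : (d <= n)%N) (kd : (k < d)%N).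

Lemma vertices_superset : exists2 B : {set 'I_n.+1},
  [set p : 'I_n.+1 | vertex i p]%SET \subset B & #|B| = d.+1.
Proof.
apply: ex_superset_card; rewrite (card_ord n.+1) ltnS dn andbT.
exact: leq_trans card_vertices (leqW kd).
Qed.

Lemma affinely_free_vertices : affinely_free (walk_vertices X).
Proof.
move=> mu mu0 muX a; have [B vB cB] := vertices_superset.
(* Up to a constant, [g] is dual to the vertex [i a]; applied to the relation it isolates [mu a]. *)
have [g [c gP]] := walk_prescribed Xfree (fun p => (p == i a)%:R) cB.
have : (\sum_b mu b *: walk_vertices X b *m g) 0 0 = 0 by rewrite -mulmx_suml muX mul0mx mxE.
rewrite summxE (eq_bigr (fun b => mu b * ((i b == i a)%:R + c))); last first.
  move=> b _; rewrite -scalemxAl mxE; congr (_ * _).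
  have bn : (i b < n.+1)%N by rewrite ltnS.
  rewrite -(gP (Ordinal bn))//; apply: (fintype.subsetP vB).
  by rewrite inE; apply/existsP; exists b.
under eq_bigr do rewrite mulrDr.
rewrite big_split/= -mulr_suml mu0 mul0r addr0 (bigD1 a)//= eqxx mulr1 big1 ?addr0//.
move=> b ba; rewrite (_ : (i b == i a) = false) ?mulr0//; apply/negbTE.
have := ba; rewrite -val_eqE neq_ltn => /orP[] /i_incr; lia.
Qed.

Lemma walk_face_support : walk_face X <-> strict_support X i.
Proof.
rewrite walk_faceE; split=> [[_ [g [c [gle gc gt]]]]|[f [c fP]]].
  have [ex|nex] := pselect (exists2 p, (p <= n)%N & (walk X p *m g) 0 0 <> c).
    by apply: strict_supportW gle gc ex.
  (* In the remaining case the functional is constant on the walk, so the hull of the vertices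
     contains every point of it. A functional equal, up to a constant, to 1 at the vertices and 0 at
     another point of [B] refutes this. *)
  have [B vB cB] := vertices_superset.
  have [p pB pv] : exists2 p, p \in B & ~~ vertex i p.
    apply/exists_inP; apply: contraT; rewrite negb_exists_in => /forall_inP H.
    suff : (#|B| <= k.+1)%N by rewrite cB; lia.
    apply: leq_trans card_vertices; apply/subset_leq_card/fintype.subsetP => p.
    by move=> /H; rewrite inE negbK.
  have [h [c' hP]] := walk_prescribed Xfree (fun p => (vertex i p)%:R) cB.
  have : convex_hull (range (walk_vertices X)) (walk X p).
    have pn : (p <= n)%N by rewrite -ltnS ltn_ord.
    by apply: gt => //; apply: contrapT => pc; apply: nex; exists p.
  rewrite convex_hull_range => -[la [_ la1 pE]].
  have := hP p pB; rewrite (negbTE pv) add0r pE mulmx_suml summxE.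
  rewrite (eq_bigr (fun b => la b * (1 + c'))); last first.
    move=> b _; rewrite -scalemxAl mxE; congr (_ * _).
    have bn : (i b < n.+1)%N by rewrite ltnS.
    have bv : vertex i (i b) by apply/existsP; exists b.
    have := hP (Ordinal bn); rewrite /= bv => -> //.
    by apply: (fintype.subsetP vB); rewrite inE.
  by rewrite -mulr_suml la1; lra.
split; first exact: affinely_free_vertices.
exists f, c; split.
- by move=> p /fP; case: ifP => // _; [move=> ->|exact: ltW].
- move=> p pv; have := fP p; rewrite pv; apply.
  by move: pv => /existsP[l /eqP <-].
- move=> p pn pc; have := fP p pn; rewrite pc ltxx; case: ifP => // /existsP[l /eqP <-] _.
  by apply: sub_convex_hull; exists l.
Qed.

End free_blocks.

End walk_faces.

(** * Measurability of the face event *)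

Section fourier_motzkin.
Context {R : realFieldType}.

Lemma ex_separator (A B : seq R) :
  (forall a b, a \in A -> b \in B -> a <= b) ->
  exists u, (forall a, a \in A -> a <= u) /\ (forall b, b \in B -> u <= b).
Proof.
elim: A => [_|a A IHA AB].
  elim: B => [|b B [u [_ uB]]]; first by exists 0.
  exists (Num.min b u); split=> // c; rewrite inE ge_min => /orP[/eqP->|/uB->].
    by rewrite lexx.
  by rewrite orbT.
have [x b xA bB|u [Au uB]] := IHA; first by apply: AB => //; rewrite inE xA orbT.
exists (Num.max a u); split=> [x|b bB].
  rewrite inE le_max => /orP[/eqP->|/Au->]; first by rewrite lexx.
  by rewrite orbT.
by rewrite ge_max uB// AB// mem_head.
Qed.

(** Rows with [c j > 0] bound [u] below and rows with [c l < 0] bound it above; [u] exists iff each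
    lower bound is at most each upper one. Clearing denominators keeps the new rows polynomial in
    the data. *)
Lemma eliminate_variable {J : finType} (v c : J -> R) :
  (exists u, forall j, 0 <= v j + c j * u) <->
  (forall j, c j = 0 -> 0 <= v j) /\
  (forall j l, 0 < c j -> c l < 0 -> 0 <= c j * v l - c l * v j).
Proof.
split=> [[u uP]|[H0 H]].
  split=> [j cj|j l cj cl]; first by have := uP j; rewrite cj mul0r addr0.
  by have := uP j; have := uP l; nra.
have [|u [uA uB]] := @ex_separator
    [seq - v j / c j | j <- enum J & 0 < c j] [seq - v j / c j | j <- enum J & c j < 0].
  move=> _ _ /mapP[j + ->] /mapP[l + ->].
  rewrite !mem_filter => /andP[cj _] /andP[cl _].
  rewrite ler_ndivlMr// mulrAC ler_pdivlMr//; have := H j l cj cl; nra.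
exists u => j; have [cj|cj|cj] := ltrgt0P (c j).
- have : - v j / c j <= u by apply: uA; apply: map_f; rewrite mem_filter cj mem_enum.
  by rewrite ler_pdivrMr//; lra.
- have : u <= - v j / c j by apply: uB; apply: map_f; rewrite mem_filter cj mem_enum.
  by rewrite ler_ndivlMr//; lra.
- by rewrite cj mul0r addr0 H0.
Qed.

End fourier_motzkin.

Section measurable_feasibility.
Context {dT : measure_display} {T : measurableType dT} {R : realType}.

Lemma measurable_holds (f : T -> bool) : measurable_fun setT f -> measurable [set t | f t].
Proof.
move=> mf; rewrite (_ : [set t | f t] = setT `&` f @^-1` [set true]).
  by apply: mf.
by rewrite setTI.
Qed.

Lemma measurable_fun_scale (c : R) (f : T -> R) :
  measurable_fun setT f -> measurable_fun setT (fun t => c * f t).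
Proof. by move=> mf; apply: measurable_funM => //; exact: measurable_cst. Qed.

Lemma measurable_forall {J : finType} (F : J -> set T) :
  (forall j, measurable (F j)) -> measurable [set t | forall j, F j t].
Proof.
move=> mF; rewrite (_ : [set t | _] = \bigcap_(j in [set: J]) F j).
  by apply: fin_bigcap_measurable => //; exact: finite_finset.
by apply/seteqP; split=> t /= H j => [_|]; exact: H.
Qed.

Lemma measurable_exists {J : finType} (F : J -> set T) :
  (forall j, measurable (F j)) -> measurable [set t | exists j, F j t].
Proof.
move=> mF; rewrite (_ : [set t | _] = \bigcup_(j in [set: J]) F j).
  by apply: fin_bigcup_measurable => //; exact: finite_finset.
by apply/seteqP; split=> t /= [j]; [exists j|exists j].
Qed.

(** The union over [u] is uncountable; eliminating the variables one at a time leaves finitely many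
    inequalities between measurable functions. *)
Lemma measurable_feasible (m : nat) (J : finType) (a : J -> 'I_m -> T -> R) (b : J -> T -> R) :
  (forall j x, measurable_fun setT (a j x)) -> (forall j, measurable_fun setT (b j)) ->
  measurable [set t | exists u : 'I_m -> R, forall j, 0 <= b j t + \sum_x a j x t * u x].
Proof.
elim: m J a b => [|m IHm] J a b ma mb.
  rewrite (_ : [set t | _] = [set t | forall j, 0 <= b j t]).
    apply: measurable_forall => j; apply: measurable_holds.
    by apply: measurable_fun_ler => //; exact: measurable_cst.
  apply/seteqP; split=> t /= => [[u H] j|H].
    by have := H j; rewrite big_ord0 addr0.
  by exists (fun=> 0) => j; rewrite big_ord0 addr0.
(* Rows of the system obtained by eliminating the variable 0: [inl j] is row
   [j] if variable 0 does not occur in it, and [inr (j, l)] is the combination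
   of rows [j] and [l] if it occurs in them with opposite signs. *)
pose row (w : J -> T -> R) (q : J + J * J) (t : T) := match q with
  | inl j => if a j ord0 t == 0 then w j t else 0
  | inr (j, l) => if (0 < a j ord0 t) && (a l ord0 t < 0)
                  then a j ord0 t * w l t - a l ord0 t * w j t else 0
  end.
have mrow w q : (forall j, measurable_fun setT (w j)) -> measurable_fun setT (row w q).
  move=> mw; case: q => [j|[j l]]; apply: measurable_fun_ifT => //.
  - by apply: measurable_fun_eqr => //; exact: measurable_cst.
  - by apply: measurable_and; apply: measurable_fun_ltr => //; exact: measurable_cst.
  - by apply: measurable_funB; apply: measurable_funM.
rewrite (_ : [set t | _] = [set t | exists u : 'I_m -> R, forall q, 0 <= row b q t +
    \sum_x row (fun j => a j (lift ord0 x)) q t * u x]).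
  by apply: IHm => [q x|q]; apply: mrow.
pose v (u : 'I_m -> R) t j := b j t + \sum_x a j (lift ord0 x) t * u x.
have rowE u t q : row b q t + \sum_x row (fun j => a j (lift ord0 x)) q t * u x =
    match q with
    | inl j => if a j ord0 t == 0 then v u t j else 0
    | inr (j, l) => if (0 < a j ord0 t) && (a l ord0 t < 0)
                  then a j ord0 t * v u t l - a l ord0 t * v u t j else 0
    end.
  rewrite /v; case: q => [j|[j l]] /=; case: ifP => _ //.
  - by rewrite add0r big1// => x _; rewrite mul0r.
  - rewrite !mulrDr !mulr_sumr opprD addrACA -sumrB; congr (_ + _).
    by apply: eq_bigr => x _; ring.
  - by rewrite add0r big1// => x _; rewrite mul0r.
apply/seteqP; split=> t /= [u H].
  exists (fun x => u (lift ord0 x)) => q; rewrite rowE.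
  have /eliminate_variable[H0 H1] : exists y, forall j,
      0 <= v (fun x => u (lift ord0 x)) t j + a j ord0 t * y.
    exists (u ord0) => j; have := H j; rewrite big_ord_recl /v.
    by congr (_ <= _); ring.
  case: q => [j|[j l]]; first by case: eqP => // /H0.
  by case: ifP => // /andP[]; exact: H1.
have [|y yP] := (eliminate_variable (v u t) (fun j => a j ord0 t)).2.
  split=> [j aj|j l aj al].
    by have := H (inl j); rewrite rowE aj eqxx.
  by have := H (inr (j, l)); rewrite rowE aj al.
exists (fun x => if unlift ord0 x is Some x' then u x' else y) => j.
rewrite big_ord_recl unlift_none; have := yP j; rewrite /v.
under [X in _ -> _ <= _ + (_ + X)]eq_bigr do rewrite liftK.
by congr (_ <= _); ring.
Qed.

Lemma measurable_solvable (m : nat) (J E : finType)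
    (a : J -> 'I_m -> T -> R) (b : J -> T -> R)
    (a' : E -> 'I_m -> T -> R) (b' : E -> T -> R) :
  (forall j x, measurable_fun setT (a j x)) -> (forall j, measurable_fun setT (b j)) ->
  (forall j x, measurable_fun setT (a' j x)) -> (forall j, measurable_fun setT (b' j)) ->
  measurable [set t | exists u : 'I_m -> R,
    (forall j, 0 <= b j t + \sum_x a j x t * u x) /\
    (forall j, b' j t + \sum_x a' j x t * u x = 0)].
Proof.
move=> ma mb ma' mb'.
pose A (q : J + E * bool) x t := match q with
  | inl j => a j x t | inr (j, s) => (-1) ^+ s * a' j x t end.
pose B (q : J + E * bool) t := match q with
  | inl j => b j t | inr (j, s) => (-1) ^+ s * b' j t end.
rewrite (_ : [set t | _] =
    [set t | exists u : 'I_m -> R, forall q, 0 <= B q t + \sum_x A q x t * u x]).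
  apply: measurable_feasible => [[j|[j s]] x|[j|[j s]]].
  - exact: ma.
  - exact: (measurable_fun_scale ((-1) ^+ s) (ma' j x)).
  - exact: mb.
  - exact: (measurable_fun_scale ((-1) ^+ s) (mb' j)).
have AB (u : 'I_m -> R) t (j : E) (s : bool) :
    B (inr (j, s)) t + \sum_x A (inr (j, s)) x t * u x =
    (-1) ^+ s * (b' j t + \sum_x a' j x t * u x).
  by rewrite mulrDr mulr_sumr; congr (_ + _); apply: eq_bigr => x _; rewrite /A mulrA.
apply/seteqP; split=> t /= => [[u [H H']]|[u H]]; exists u.
  by move=> [j|[j s]]; [exact: H|rewrite AB H' mulr0].
split=> j; first exact: (H (inl j)).
have := H (inr (j, false)); have := H (inr (j, true)); rewrite !AB; lra.
Qed.

End measurable_feasibility.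

(** * The face event as a finite combination of linear systems *)

Section measurable_faces.
Context {R : realType} {n d : nat}.
Implicit Types X : 'M[R]_(n, d).

Lemma measurable_entry a b : measurable_fun setT (fun X : 'M[R]_(n, d) => X a b).
Proof.
move=> _ B mB; rewrite setTI; apply: sub_gen_smallest.
by exists a, b, B.
Qed.

Lemma walkE X p b : walk X p 0 b = \sum_(j < n | (j < p)%N) X j b.
Proof. by rewrite /walk summxE; apply: eq_bigr => j _; rewrite mxE. Qed.

Lemma measurable_walk p b : measurable_fun setT (fun X : 'M[R]_(n, d) => walk X p 0 b).
Proof.
under eq_fun do rewrite walkE big_mkcond.
apply: measurable_sum => j; case: (j < p)%N; first exact: measurable_entry.
exact: measurable_cst.
Qed.

Section face.
Context {k : nat}.
Variable i : 'I_k.+1 -> nat.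
Hypothesis i_le_n : forall a : 'I_k.+1, (i a <= n)%N.

(** The normalization [mu a = 1] expresses a nonzero coefficient by a linear equation. *)
Definition dependent_at X (a : 'I_k.+1) := exists mu : 'I_k.+1 -> R,
  [/\ mu a = 1, \sum_b mu b = 0 & \sum_b mu b *: walk X (i b) = 0].

(** With the contact set [J] fixed, rescaling the functional turns strict inequalities off [J] into
    weak ones with bound 1. *)
Definition supported X (J : {set 'I_n.+1}) := exists g : 'I_d -> R,
  forall p : 'I_n.+1, if p \in J
    then \sum_j (walk X (i ord0) 0 j - walk X p 0 j) * g j = 0
    else 1 <= \sum_j (walk X (i ord0) 0 j - walk X p 0 j) * g j.

Definition spanned X (p : nat) := exists la : 'I_k.+1 -> R,
  [/\ forall a, 0 <= la a, \sum_a la a = 1 & walk X p = \sum_a la a *: walk X (i a)].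

(** Splitting by the finitely many possible contact sets replaces the quantifier over functionals by
    solvability of linear systems with entries depending measurably on [X]. *)
Lemma walk_face_finite X : walk_face i X <->
  ~ (exists a, dependent_at X a) /\
  exists J : {set 'I_n.+1}, (forall a, inord (i a) \in J) /\
    supported X J /\ forall p, p \in J -> spanned X p.
Proof.
rewrite (walk_faceE i_le_n).
have -> : affinely_free (walk_vertices i X) <-> ~ exists a, dependent_at X a.
  split=> [free [a [mu [mua mu0 muX]]]|nd mu mu0 muX a].
    by have := free mu mu0 muX a; rewrite mua => /eqP; rewrite oner_eq0.
  apply/eqP/negPn/negP => mua; apply: nd; exists a, (fun b => mu b / mu a); split.
  - exact: divff.
  - by rewrite -mulr_suml mu0 mul0r.
  - have := congr1 (fun v => (mu a)^-1 *: v) muX; rewrite scaler0 scaler_sumr => E0.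
    rewrite -[RHS]E0.
    by apply: eq_bigr => b _; rewrite scalerA mulrC.
have gapE (g : 'cV[R]_d) (p : nat) e :
    \sum_j (walk X (i ord0) 0 j - walk X p 0 j) * (e * g j 0) =
    e * ((walk X (i ord0) *m g) 0 0 - (walk X p *m g) 0 0).
  have E q : (walk X q *m g) 0 0 = \sum_j walk X q 0 j * g j 0 by rewrite mxE.
  by rewrite !E -sumrB mulr_sumr; apply: eq_bigr => j _; ring.
have hullE p : convex_hull (range (walk_vertices i X)) (walk X p) <-> spanned X p.
  by rewrite convex_hull_range.
have inK a : (inord (i a) : 'I_n.+1) = i a :> nat by rewrite inordK// ltnS.
split=> -[H b]; split=> {H}//.
  case: b => [g [c [gle gc gt]]].
  have g0 : (walk X (i ord0) *m g) 0 0 = c by apply: gc; apply/existsP; exists ord0.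
  pose J := [set p : 'I_n.+1 | (walk X p *m g) 0 0 == c]%SET.
  exists J; split; first by move=> a; rewrite inE inK gc//; apply/existsP; exists a.
  split; last first.
    move=> p; rewrite inE => /eqP pc; apply/hullE; apply: (gt p _ pc).
    by rewrite -ltnS ltn_ord.
  (* Here [e] is a common lower bound of the finitely many positive defects; dividing by it makes
     them at least 1. *)
  have [e e0 He] := @perturb_pos R _ [seq p <- enum 'I_n.+1 | p \notin J]
    (fun p : 'I_n.+1 => c - (walk X p *m g) 0 0) (fun=> -1)
    (fun p => ltac:(rewrite mem_filter inE subr_gt0 lt_neqAle => /andP[-> _];
      exact: (gle p (ltn_ord p)))).
  exists (fun j => e^-1 * g j 0) => p; rewrite gapE g0; case: ifP => pJ.
    by move: pJ; rewrite inE => /eqP ->; rewrite subrr mulr0.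
  rewrite ler_pdivlMl// mulr1; have := He p; rewrite mem_filter pJ mem_enum => /(_ isT).
  by rewrite mulrN1 subr_gt0 => /ltW.
case: b => [J [iJ [[g gP] Jspan]]].
have gE p : \sum_j (walk X (i ord0) 0 j - walk X p 0 j) * g j =
    (walk X (i ord0) *m (\col_j g j)) 0 0 - (walk X p *m (\col_j g j)) 0 0.
  by rewrite -[RHS]mul1r -gapE; apply: eq_bigr => j _; rewrite mxE mul1r.
have {}gP (p : nat) : (p <= n)%N -> if inord p \in J
    then (walk X p *m (\col_j g j)) 0 0 = (walk X (i ord0) *m (\col_j g j)) 0 0
    else (walk X p *m (\col_j g j)) 0 0 < (walk X (i ord0) *m (\col_j g j)) 0 0.
  move=> pn; have := gP (inord p); rewrite gE inordK//; case: ifP => _; lra.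
exists (\col_j g j), ((walk X (i ord0) *m (\col_j g j)) 0 0); split.
- by move=> p /gP; case: ifP => _; [move=> ->|exact: ltW].
- by move=> p /existsP[a /eqP <-]; have := gP (i a) (i_le_n a); rewrite iJ.
- move=> p pn pg; have := gP p pn; rewrite pg ltxx; case: ifP => // pJ _.
  by apply/hullE; have := Jspan _ pJ; rewrite inordK.
Qed.

Lemma measurable_dependent a : measurable [set X | dependent_at X a].
Proof.
pose al (q : option (option 'I_d)) (b : 'I_k.+1) X : R := match q with
  | None => (b == a)%:R | Some None => 1 | Some (Some j) => walk X (i b) 0 j end.
pose be (q : option (option 'I_d)) X : R := if q is None then - 1 else 0.
rewrite (_ : [set X | _] = [set X | exists u : 'I_k.+1 -> R,
    (forall j : 'I_0, 0 <= 0 + \sum_x 0 * u x) /\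
    (forall q, be q X + \sum_x al q x X * u x = 0)]).
  apply: (@measurable_solvable _ _ _ _ 'I_0 _ (fun=> fun=> cst 0) (fun=> cst 0)) => //.
  - by move=> [[j|]|] x; [exact: measurable_walk|exact: measurable_cst|exact: measurable_cst].
  - by move=> [q|]; exact: measurable_cst.
apply/seteqP; split=> X /= [u].
  move=> [ua u0 uX]; exists u; split; first by case.
  move=> [[j|]|] /=.
  - have := congr1 (fun v : 'rV_d => v 0 j) uX; rewrite summxE mxE add0r => E0; rewrite -[RHS]E0.
    by apply: eq_bigr => b _; rewrite mxE mulrC.
  - by rewrite add0r -[RHS]u0; apply: eq_bigr => b _; rewrite mul1r.
  - rewrite (bigD1 a)//= eqxx ua big1 ?addr0; first by rewrite mul1r addNr.
    by move=> b /negbTE ->; rewrite mul0r.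
move=> [_ H]; exists u; split.
- have := H None; rewrite /= (bigD1 a)//= eqxx big1 ?addr0; first by rewrite mul1r; lra.
  by move=> b /negbTE ->; rewrite mul0r.
- have := H (Some None); rewrite /= add0r => E0; rewrite -[RHS]E0.
  by apply: eq_bigr => b _; rewrite mul1r.
- apply/rowP => j; have := H (Some (Some j)); rewrite /= add0r summxE mxE => E0; rewrite -[RHS]E0.
  by apply: eq_bigr => b _; rewrite mxE mulrC.
Qed.

Lemma measurable_spanned p : measurable [set X | spanned X p].
Proof.
pose al (q : option 'I_d) (b : 'I_k.+1) X : R :=
  if q is Some j then walk X (i b) 0 j else 1.
pose be (q : option 'I_d) X : R := if q is Some j then (-1) * walk X p 0 j else - 1.
rewrite (_ : [set X | _] = [set X | exists u : 'I_k.+1 -> R,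
    (forall j : 'I_k.+1, 0 <= 0 + \sum_x (x == j)%:R * u x) /\
    (forall q, be q X + \sum_x al q x X * u x = 0)]).
  apply: (@measurable_solvable _ _ _ _ _ _ (fun j x => cst (x == j)%:R) (fun=> cst 0)) => //.
  - by move=> [j|] x; [exact: measurable_walk|exact: measurable_cst].
  - move=> [j|]; last exact: measurable_cst.
    exact: (measurable_fun_scale (-1) (measurable_walk p j)).
have diag (u : 'I_k.+1 -> R) j : 0 + \sum_x (x == j)%:R * u x = u j.
  by rewrite add0r (bigD1 j)//= eqxx mul1r big1 ?addr0// => x /negbTE ->; rewrite mul0r.
apply/seteqP; split=> X /= [u].
  move=> [u0 u1 uX]; exists u; split; first by move=> j; rewrite diag.
  move=> [j|] /=.
  - rewrite uX summxE mulN1r addrC; apply/eqP; rewrite subr_eq0; apply/eqP.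
    by apply: eq_bigr => b _; rewrite mxE mulrC.
  - rewrite addrC; apply/eqP; rewrite subr_eq0 -[X in _ == X]u1; apply/eqP.
    by apply: eq_bigr => b _; rewrite mul1r.
move=> [H0 H]; exists u; split.
- by move=> j; rewrite -diag.
- have := H None; rewrite /=; under eq_bigr do rewrite mul1r.
  lra.
- apply/rowP => j; have := H (Some j); rewrite /= mulN1r => /eqP.
  rewrite addrC subr_eq0 => /eqP <-.
  by rewrite summxE; apply: eq_bigr => b _; rewrite mxE mulrC.
Qed.

Lemma measurable_supported J : measurable [set X | supported X J].
Proof.
pose gap (p : 'I_n.+1) (j : 'I_d) X := walk X (i ord0) 0 j - walk X p 0 j.
have mgap p j : measurable_fun setT (gap p j).
  by apply: measurable_funB; exact: measurable_walk.
pose al (s : bool) (p : 'I_n.+1) (j : 'I_d) : 'M[R]_(n, d) -> R :=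
  if (p \in J) == s then gap p j else cst 0.
have mal s p j : measurable_fun setT (al s p j).
  by rewrite /al; case: (_ == _) => //; exact: measurable_cst.
rewrite (_ : [set X | _] = [set X | exists u : 'I_d -> R,
    (forall p, cst (if p \in J then 0 else - 1 : R) X + \sum_x al false p x X * u x >= 0) /\
    (forall p, cst 0 X + \sum_x al true p x X * u x = 0)]).
  apply: (@measurable_solvable _ _ _ _ _ _ (al false)
    (fun p => cst (if p \in J then 0 else - 1 : R)) (al true) (fun=> cst 0)) => //.
have zero (u : 'I_d -> R) : \sum_x 0 * u x = 0 by rewrite big1// => x _; rewrite mul0r.
apply/seteqP; split=> X /= [u].
  move=> H; exists u; split=> p; have := H p; rewrite /al; case: (p \in J) => /=.
  - by rewrite zero addr0.
  - by rewrite /gap; lra.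
  - by rewrite /gap add0r.
  - by rewrite zero addr0.
move=> [H H'] ; exists u => p; have := H p; have := H' p.
by rewrite /al; case: (p \in J) => /=; rewrite /gap; lra.
Qed.

Lemma measurable_walk_face : measurable [set X : 'M[R]_(n, d) | walk_face i X].
Proof.
pose good (J : {set 'I_n.+1}) : set 'M[R]_(n, d) := [set X | (forall a, inord (i a) \in J) /\
  supported X J /\ forall p, p \in J -> spanned X p].
rewrite (_ : [set X | _] =
    ~` [set X | exists a, dependent_at X a] `&` [set X | exists J, good J X]); last first.
  by apply/seteqP; split=> X /= /walk_face_finite.
apply: measurableI; first by apply/measurableC/measurable_exists; exact: measurable_dependent.
apply: measurable_exists => J; rewrite /good.
have [iJ|niJ] := pselect (forall a, inord (i a) \in J); last first.
  rewrite (_ : [set X | _] = set0) //.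
  by apply/seteqP; split=> X //= [].
pose spans (p : 'I_n.+1) : set 'M[R]_(n, d) := [set X | p \in J -> spanned X p].
rewrite (_ : [set X | _] = [set X | supported X J] `&` [set X | forall p, spans p X]).
  apply: measurableI; first exact: measurable_supported.
  apply: measurable_forall => p; rewrite /spans; case: (p \in J).
    rewrite (_ : [set X | _] = [set X | spanned X p]); first exact: measurable_spanned.
    by apply/seteqP; split=> X /=; [exact|].
  rewrite (_ : [set X | _] = setT); first exact: measurableT.
  by apply/seteqP; split=> X.
by apply/seteqP; split=> X /= [] => [_ []|].
Qed.

End face.
End measurable_faces.

(** * Counting *)

Section level_sizes.
Local Open Scope set_scope.
Context {n k : nat}.
Variable i : 'I_k.+1 -> nat.
Hypothesis i_incr : forall a b : 'I_k.+1, (a < b)%N -> (i a < i b)%N.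
Hypothesis i_le_n : forall a : 'I_k.+1, (i a <= n)%N.

Lemma vertex_le_block l p : (i l <= p)%N = (l < block i p)%N.
Proof.
rewrite -[block i p]/(#|_|) -downset_ord ?inE// => q r qr; rewrite !inE.
by apply: leq_trans; exact: i_mono.
Qed.

Definition block_start (p : nat) : nat :=
  if block i p is c.+1 then i (inord c) else 0.

Lemma block_start_le p : (block_start p <= p)%N.
Proof.
rewrite /block_start; case E : (block i p) => [//|c].
have ck : (c < k.+1)%N.
  by rewrite -ltnS -E ltnS -[X in (_ <= X)%N]card_ord max_card.
by rewrite vertex_le_block E inordK.
Qed.

Lemma block_start_eq p q : (q <= p)%N -> (block i q == block i p) = (block_start p <= q)%N.
Proof.
move=> qp; rewrite /block_start; case E : (block i p) => [|c].
  by have := block_mono i qp; rewrite E leqn0.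
have ck : (c < k.+1)%N.
  by rewrite -ltnS -E ltnS -[X in (_ <= X)%N]card_ord max_card.
rewrite vertex_le_block inordK//; have := block_mono i qp; rewrite E; lia.
Qed.

Lemma card_same_block (a : 'I_n) :
  #|[set b : 'I_n | (b < a)%N && (block i b == block i a)]| = (a - block_start a)%N.
Proof.
have sa := block_start_le a; have an := ltn_ord a.
have -> : [set b : 'I_n | (b < a)%N && (block i b == block i a)] =
    [set b : 'I_n | (b < a)%N] :\: [set b : 'I_n | (b < block_start a)%N].
  apply/finset.setP => b; rewrite !inE -leqNgt andbC.
  by case: (ltnP b a) => [ba|]; rewrite ?andbF// block_start_eq// ltnW.
rewrite cardsD (_ : _ :&: _ = [set b : 'I_n | (b < block_start a)%N]).
  by rewrite !card_ord_lt//; lia.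
by apply/finset.setP => b; rewrite !inE; lia.
Qed.

(** Along an inner block the sizes are 0, 1, 2, ...; along an outer one the forms [z_p] and
    [z_p + z_b] are added and the sizes are 1, 3, 5, ... These are the shifts in the factors of
    [face_poly]. *)
Lemma size_form_level p : (p < n)%N -> size (@form_level n k i p) =
  if sign_allowed i p then (2 * (p - block_start p) + 1)%N else (p - block_start p)%N.
Proof.
move=> pn; pose a := Ordinal pn.
pose s := [seq b : 'I_n <- enum 'I_n | (b < a)%N && (block i b == block i a)].
have mems b : (b \in s) = (b < p)%N && (block i b == block i p).
  by rewrite mem_filter mem_enum andbT.
have us : uniq s by rewrite filter_uniq// enum_uniq.
have ss : size s = (p - block_start p)%N.
  rewrite -[p]/(val a) -card_same_block -(card_uniqP us).
  by apply: eq_card => b; rewrite mems inE.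
pose f (e : bool) (b : 'I_n) : form := (a, Some (e, b)).
have finj e : injective (f e) by move=> b c [].
pose L := [seq f false b | b <- s] ++
  if sign_allowed i p then (a, None) :: [seq f true b | b <- s] else [::].
have memf e o b : ((b, o) \in [seq f e x | x <- s]) =
    (b == a) && (if o is Some (e', c) then (e' == e) && (c \in s) else false).
  apply/mapP/idP => [[x xs [-> ->]]|]; first by rewrite !eqxx.
  by case: o => [[e' c]|]; rewrite ?andbF// => /and3P[/eqP-> /eqP-> cs]; exists c.
have uL : uniq L.
  rewrite /L cat_uniq map_inj_uniq// us /=; case: ifP => //= _.
  rewrite map_inj_uniq// us !memf eqxx /= andbT; apply/hasPn => -[b o].
  rewrite !memf; case: o => [[[] c]|]; rewrite /= ?andbF//.
have -> : size (@form_level n k i p) = size L.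
  apply/perm_size/uniq_perm => //; first by rewrite filter_uniq// enum_uniq.
  move=> [b o]; rewrite mem_form_level mem_cat memf /form_ok /=.
  rewrite -[(_ == p)]/(val b == val a) val_eqE.
  case: (eqVneq b a) => [->|ba] /=; last first.
    rewrite andbF; apply/esym; case: ifP => // _; rewrite inE memf (negbTE ba) orbF.
    by apply/negbTE; apply: contraNneq ba => -[->].
  rewrite andbT; case: o => [[e c]|] /=.
    rewrite -[sign_allowed i p]/(sign_allowed i a).
    by case: (sign_allowed i a); case: e;
      rewrite /= ?inE ?memf ?mems ?xpair_eqE ?eqxx /= ?andbT ?orbF ?andbF.
  by case: ifP => /= sa; rewrite ?inE ?eqxx.
rewrite size_cat size_map ss; case: ifP => _ /=; last by rewrite addn0.
by rewrite size_map ss; lia.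
Qed.

(** An outer block contains size 1 at its first coordinate and an inner block at its second. The
    first level of an inner block is empty and inherits the property from the levels below. *)
Lemma starts_with_one_levels p : (p <= n)%N ->
  starts_with_one (map size (@form_levels n k i p)).
Proof.
elim: p => //= p IHp pn; split; last exact: IHp (ltnW pn).
have mem_size q : (q < p)%N ->
    size (@form_level n k i q) \in map size (@form_levels n k i p).
  clear; elim: p => // p IHp; rewrite ltnS leq_eqVlt /= inE.
  by move=> /orP[/eqP->|/IHp->]; rewrite ?eqxx ?orbT.
have sp := block_start_le p.
have st q : (block_start p <= q <= p)%N -> block_start q = block_start p.
  case/andP=> pq qp; rewrite /block_start.
  by have /eqP -> : block i q == block i p by rewrite block_start_eq.
have sgn q : (block_start p <= q <= p)%N -> sign_allowed i q = sign_allowed i p.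
  case/andP=> pq qp; apply: sign_allowed_block => //.
  by apply/eqP; rewrite block_start_eq.
have [sa|sa] := boolP (sign_allowed i p).
  right; rewrite inE; have := sp; rewrite leq_eqVlt => /orP[/eqP E|lt].
    by rewrite size_form_level// sa E subnn.
  have <- : size (@form_level n k i (block_start p)) = 1%N.
    by rewrite size_form_level ?sgn ?leqnn ?sp ?sa ?st ?leqnn ?sp ?subnn//; lia.
  by rewrite mem_size ?orbT.
rewrite inE size_form_level// (negbTE sa).
have := sp; rewrite leq_eqVlt => /orP[/eqP E|lt].
  rewrite E subnn /=; case: p {mem_size sp st sgn sa E} pn IHp => [|p] pn IHp; first by left.
  have [[H|H] _] := IHp (ltnW pn); [left|right] => //.
right; have [->|p1] := eqVneq p (block_start p).+1; first by rewrite st ?leqnSn ?lt//; lia.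
have <- : size (@form_level n k i (block_start p).+1) = 1%N.
  by rewrite size_form_level ?sgn ?(negbTE sa) ?st; lia.
by rewrite mem_size ?orbT//; lia.
Qed.

End level_sizes.

(** * Products over the level sizes *)

Section block_products.
Context {n k : nat}.
Variable i : 'I_k.+1 -> nat.
Hypothesis i_incr : forall a b : 'I_k.+1, (a < b)%N -> (i a < i b)%N.
Hypothesis i_le_n : forall a : 'I_k.+1, (i a <= n)%N.

Lemma prod_telescope {A : comNzRingType} (u : nat -> nat) m (F : nat -> A) :
  (forall l, (l < m)%N -> (u l <= u l.+1)%N) ->
  \prod_(u 0%N <= p < u m) F p = \prod_(l < m) \prod_(u l <= p < u l.+1) F p.
Proof.
elim: m => [|m IHm] um; first by rewrite big_ord0 big_geq.
have u0m : (u 0 <= u m)%N.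
  elim: m um {IHm} => // m IHm um; apply: leq_trans (um m _); last exact: ltnW.
  by apply: IHm => l lm; apply: um; exact: ltnW.
rewrite big_ord_recr /= -IHm => [|l lm]; last by apply: um; exact: ltnW.
by rewrite -big_cat_nat//= um.
Qed.

Lemma prod_blocks {A : comNzRingType} (F : nat -> A) :
  \prod_(0 <= p < n) F p =
  \prod_(0 <= p < i ord0) F p * \prod_(i ord_max <= p < n) F p *
  \prod_(l < k) \prod_(i (widen_ord (leqnSn k) l) <= p < i (lift ord0 l)) F p.
Proof.
pose u l := i (inord l).
have u0 : i ord0 = u 0%N by congr i; apply: val_inj; rewrite /= inordK.
have uk : i ord_max = u k by congr i; apply: val_inj; rewrite /= inordK.
have im := @i_mono k i i_incr.
have -> : \prod_(l < k) \prod_(i (widen_ord (leqnSn k) l) <= p < i (lift ord0 l)) F p =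
    \prod_(i ord0 <= p < i ord_max) F p.
  rewrite u0 uk prod_telescope => [|l lk]; last by apply: im; rewrite !inordK; lia.
  apply: eq_bigr => l _; have lk := ltn_ord l; rewrite /u.
  by congr (\prod_(i _ <= p < i _) F p); apply: val_inj; rewrite /= inordK// ltnS; lia.
rewrite (@big_cat_nat _ _ _ (i ord0) 0 n)//= -mulrA; congr (_ * _).
rewrite mulrC -big_cat_nat//=; apply: im; exact: leq0n.
Qed.

Lemma block_start_first p : (p < i ord0)%N -> block_start i p = 0%N.
Proof. by rewrite first_block// /block_start => /eqP ->. Qed.

Lemma block_start_last p : (i ord_max <= p)%N -> block_start i p = i ord_max.
Proof.
rewrite last_block// /block_start => /eqP ->; congr i.
by apply: val_inj; rewrite /= inordK.
Qed.

Lemma block_start_middle (l : 'I_k) p : (i (widen_ord (leqnSn k) l) <= p < i (lift ord0 l))%N ->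
  block_start i p = i (widen_ord (leqnSn k) l).
Proof.
rewrite ltnNge !vertex_le_block//= /bump /= add1n => lp.
have -> : block_start i p = i (inord l).
  by rewrite /block_start (_ : block i p = l.+1)//; move: lp; lia.
by congr i; apply: val_inj; rewrite /= inordK// ltnS ltnW.
Qed.

Lemma prod_levels {A : comNzRingType} (G : nat -> A) :
  \prod_(x <- map size (@form_levels n k i n)) G x =
  \prod_(0 <= m < i ord0) G (2 * m + 1)%N *
  \prod_(0 <= m < n - i ord_max) G (2 * m + 1)%N *
  \prod_(l < k) \prod_(0 <= m < gap i l) G m.
Proof.
have -> : \prod_(x <- map size (@form_levels n k i n)) G x =
    \prod_(0 <= p < n) G (size (@form_level n k i p)).
  suff H m : \prod_(x <- map size (@form_levels n k i m)) G x =
      \prod_(0 <= p < m) G (size (@form_level n k i p)) by exact: H.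
  elim: m => [|m IHm]; first by rewrite big_nil big_geq.
  by rewrite /= big_cons IHm big_nat_recr//= mulrC.
rewrite prod_blocks; congr (_ * _ * _).
- apply: eq_big_nat => p /andP[_ p0]; have i0 := i_le_n ord0.
  by rewrite size_form_level//; [rewrite /sign_allowed p0 block_start_first// subn0|lia].
- rewrite -{1}[i ord_max]add0n big_addn; apply: eq_big_nat => p /andP[_ pn].
  rewrite size_form_level//; last by lia.
  by rewrite /sign_allowed leq_addl orbT block_start_last ?leq_addl// addnK.
- apply: eq_bigr => l _; rewrite -{1}[i (widen_ord _ _)]add0n big_addn.
  apply: eq_big_nat => p /andP[_ pn].
  have lip : (i (widen_ord (leqnSn k) l) <= p + i (widen_ord (leqnSn k) l) < i (lift ord0 l))%N.
    by move: pn; rewrite /gap; lia.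
  have iln := i_le_n (lift ord0 l).
  have im := @i_mono k i i_incr.
  have i0l := im ord0 (widen_ord (leqnSn k) l) (leq0n _).
  have ilk := im (lift ord0 l) ord_max (ltn_ord (lift ord0 l)).
  rewrite size_form_level//; last by lia.
  rewrite ifF; last by rewrite /sign_allowed; lia.
  by rewrite (block_start_middle lip) addnK.
Qed.

(** An outer block of length m contributes 2, 4, ..., 2m, the order of the signed permutation group,
    and an inner one the order of the symmetric group. *)
Lemma count_one_add {R : realFieldType} :
  \prod_(x <- map size (@form_levels n k i n)) (1 + x%:R) =
  2 ^+ (i ord0 + n - i ord_max) * (i ord0)`!%:R * (\prod_(l < k) (gap i l)`!%:R)
    * (n - i ord_max)`!%:R :> R.
Proof.
have fact m : \prod_(0 <= p < m) (1 + p%:R) = m`!%:R :> R.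
  elim: m => [|m IHm]; first by rewrite big_geq.
  by rewrite big_nat_recr//= IHm factS natrM mulrC nat1r.
have fact2 m : \prod_(0 <= p < m) (1 + (2 * p + 1)%N%:R) = 2 ^+ m * m`!%:R :> R.
  elim: m => [|m IHm]; first by rewrite big_geq// expr0 mul1r.
  rewrite big_nat_recr//= IHm factS exprS natrM.
  have -> : 1 + (2 * m + 1)%N%:R = 2 * m.+1%:R :> R by rewrite -natrM nat1r; congr _%:R; lia.
  by ring.
rewrite (prod_levels (fun x => 1 + x%:R)) !fact2 -addnBA// exprD.
by under eq_bigr do rewrite fact; ring.
Qed.

(** Each of the [k] inner blocks opens with an empty level, which gives a factor ['X]; this shifts
    the leading index from [d - 1] to [d - k - 1]. *)
Lemma mon_poly_levels {R : realType} :
  mon_poly (map size (@form_levels n k i n)) = 'X^k * @face_poly R n k i.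
Proof.
rewrite /mon_poly (prod_levels (fun x => 'X + x%:R)) /face_poly mulrCA; congr (_ * _).
rewrite -[k in 'X^k]card_ord -prodr_const -big_split /=; apply: eq_bigr => l _.
rewrite big_ltn ?addr0//.
have := @i_incr (widen_ord (leqnSn k) l) (lift ord0 l); rewrite /= /bump leq0n /gap; lia.
Qed.

(** The terms dropped by the guard of [altsum] and those killed by ['X^k] are exactly the ones with
    a negative index in [face_coef]. *)
Lemma altsum_face_coef {R : realType} d :
  altsum (mon_poly (map size (@form_levels n k i n))) d =
  \sum_(0 <= m < d) face_coef n i (d%:Z - k%:Z - 1 - 2 * m%:Z) :> R.
Proof.
rewrite mon_poly_levels /altsum big_mkcond; apply: eq_big_nat => m /andP[_ md].
rewrite coefXnM; case: ltnP => dm.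
  have [dk|kd] := ltnP.
  - have -> : d%:Z - k%:Z - 1 - 2 * m%:Z = Negz (k - (d - 1 - 2 * m) - 1) by lia.
    by [].
  - have -> : d%:Z - k%:Z - 1 - 2 * m%:Z = Posz (d - 1 - 2 * m - k) by lia.
    by [].
have -> : d%:Z - k%:Z - 1 - 2 * m%:Z = Negz (k + 2 * m - d) by lia.
by [].
Qed.

End block_products.

(** * Signed permutations of the steps *)

Section signed_permutations.
Context {R : realFieldType} {n d : nat}.
Implicit Types (X : 'M[R]_(n, d)) (h : {perm 'I_n} * {ffun 'I_n -> bool}).

Definition act h X : 'M[R]_(n, d) := \matrix_(j < n) ((-1) ^+ h.2 j *: row (h.1 j) X).

Lemma mul_act {m} h X (C : 'M[R]_(m, n)) :
  C *m act h X =
  (\matrix_(r, j) ((-1) ^+ h.2 (h.1^-1%g j) * C r (h.1^-1%g j))) *m X.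
Proof.
apply/matrixP => r c; rewrite !mxE [RHS](reindex_inj (@perm_inj _ h.1)) /=.
by apply: eq_bigr => j _; rewrite !mxE permK; ring.
Qed.

Lemma blocks_free_act h X : blocks_free X -> blocks_free (act h X).
Proof.
move=> Xfree C [C1 C2 C3]; rewrite mul_act; apply: Xfree.
have nz (a b : bool) (x : R) : ((-1) ^+ a * x != 0) = (x != 0).
  by rewrite mulf_eq0 signr_eq0.
split.
- move=> r j; rewrite mxE; have [->|[e ->]] := C1 r (h.1^-1%g j).
    by left; rewrite mulr0.
  by right; exists (h.2 (h.1^-1%g j) (+) e); rewrite signr_addb.
- by move=> r r' j; rewrite !mxE !mulf_eq0 !signr_eq0 /=; exact: C2.
- by move=> r; have [j Cj] := C3 r; exists (h.1 j); rewrite mxE permK mulf_eq0 signr_eq0.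
Qed.

(* Enumerating the blocks of [C] one after the other turns them into the
   differences of successive partial sums of a signed permutation of the rows. *)
Lemma partial_sums_blocks X :
  (forall h (t : {ffun 'I_d -> 'I_n.+1}), (forall a, (0 < t a)%N) ->
     (forall a b : 'I_d, (a < b)%N -> (t a < t b)%N) ->
     \matrix_(a < d) walk (act h X) (t a) \in unitmx) ->
  blocks_free X.
Proof.
move=> Xgp C [C1 C2 C3].
(* Steps outside all blocks get the value [d], so that sorting puts them last. *)
pose kappa (j : 'I_n) := if [pick r | C r j != 0] is Some r then val r else d.
have kappaE r j : C r j != 0 -> kappa j = r.
  rewrite /kappa => Crj; case: pickP => [r' Cr'j|/(_ r)]; last by rewrite Crj.
  by congr val; apply: C2 Cr'j Crj.
have [s ss] := sort_perm_nat kappa.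
pose e := [ffun p => [exists r, C r (s p) == -1]].
pose t := [ffun a : 'I_d => inord #|[set j | (kappa j < a.+1)%N]%SET| : 'I_n.+1].
have tE a : t a = #|[set j | (kappa j < a.+1)%N]%SET| :> nat.
  by rewrite ffunE inordK// ltnS -[X in (_ <= X)%N]card_ord max_card.
have ts (p : 'I_n) a : (p < t a)%N = (kappa (s p) <= a)%N.
  by rewrite tE -(count_perm_lt _ _ ss).
have t0 a : (0 < t a)%N.
  have [j Caj] := C3 a; rewrite tE; apply/card_gt0P; exists j.
  by rewrite inE (kappaE _ _ Caj).
have tlt (a b : 'I_d) : (a < b)%N -> (t a < t b)%N.
  move=> ab; rewrite !tE; apply: proper_card; apply/properP; split.
    by apply/fintype.subsetP => j; rewrite !inE => /leq_trans; apply; exact: ltnW.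
  have [j Cbj] := C3 b; exists j; rewrite inE (kappaE _ _ Cbj)// -leqNgt//.
have := Xgp (s, e) t t0 tlt.
(* The partial sum at [t a] collects the blocks 0 to [a], whence a triangular matrix of ones times
   [C *m X]; invertibility of the product gives that of the second factor. *)
have -> : \matrix_(a < d) walk (act (s, e) X) (t a) =
    (\matrix_(a < d, r < d) (r <= a)%N%:R) *m (C *m X).
  apply/row_matrixP => a; rewrite rowK row_mul mulmxA.
  rewrite /walk big_mkcond mulmx_sum_row.
  rewrite [RHS](reindex_inj (@perm_inj _ s)); apply: eq_bigr => p _.
  have -> : (row a (\matrix_(a < d, r < d) (r <= a)%N%:R) *m C) 0 (s p) =
      \sum_(r < d) (r <= a)%N%:R * C r (s p).
    by rewrite mxE; apply: eq_bigr => r _; rewrite !mxE.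
  rewrite rowK /= ts ffunE.
  have [r Cr|C0] := pickP (fun r => C r (s p) != 0); last first.
    have -> : kappa (s p) = d by rewrite /kappa; case: pickP => // r; rewrite C0.
    rewrite leqNgt ltn_ord big1 ?scale0r// => r _.
    by have /negbFE/eqP -> := C0 r; rewrite mulr0.
  rewrite (kappaE _ _ Cr) (bigD1 r)//= big1 ?addr0 => [|r' r'r]; last first.
    apply/eqP; rewrite mulf_eq0; apply/orP; right.
    by apply: contraNT r'r => Cr'; apply/eqP/(C2 _ _ _ Cr' Cr).
  case: leqP => _; last by rewrite mul0r scale0r.
  rewrite mul1r; congr (_ *: _).
  have [|[e' Ce']] := C1 r (s p); first by move/eqP; rewrite (negbTE Cr).
  rewrite Ce'; congr (_ ^+ _); congr nat_of_bool.
  apply/existsP/idP => [[r' /eqP Cr']|e'T].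
    have r'r : r' = r.
      by apply: (C2 _ _ (s p)) => //; rewrite Cr' oppr_eq0 oner_eq0.
    move: Cr'; rewrite r'r Ce'; case: (e') => //.
    by rewrite expr0; lra.
  by exists r; rewrite Ce' e'T.
by rewrite unitmx_mul => /andP[].
Qed.

End signed_permutations.

(** * Counting the group elements that produce the face *)

Section face_count.
Local Open Scope set_scope.
Context {R : realType} {n k : nat}.
Variable i : 'I_k.+1 -> nat.
Hypothesis i_incr : forall a b : 'I_k.+1, (a < b)%N -> (i a < i b)%N.
Hypothesis i_le_n : forall a : 'I_k.+1, (i a <= n)%N.

Lemma met_chambers_kernel {d} (X : 'M[R]_(n, d)) : (d <= n)%N -> blocks_free X ->
  met_chambers i [set z : 'rV[R]_n | z *m X = 0]%classic =
  region_count (map size (@form_levels n k i n)) (n - d).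
Proof.
move=> dn Xfree; apply: met_chambers_count => //.
  split; first by rewrite /= mul0mx.
  by move=> a u v /= u0 v0; rewrite mulmxDl -scalemxAl u0 v0 scaler0 addr0.
exact: generic_kernel.
Qed.

Lemma base_chamber_nonempty : exists y : 'rV[R]_n, base_chamber i y.
Proof.
exists (\row_p (if (p < i ord0)%N then p.+1%:R else p%:R - n%:R)).
apply/base_chamberP => //; split=> [p q pq /block_sides[//|E _]|p p0|p pm]; rewrite !mxE.
- by rewrite E; case: ifP => _; rewrite ?ltrD2r ltr_nat.
- by rewrite p0.
- rewrite ifF; first by rewrite subr_lt0 ltr_nat.
  by have := @i_mono k i i_incr ord0 ord_max (leq0n _); lia.
Qed.

Lemma unfold_chamber (h : {perm 'I_n} * {ffun 'I_n -> bool}) (y : 'rV[R]_n) :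
  exists z : 'rV[R]_n, \row_p ((-1) ^+ h.2 p * z 0 (h.1 p)) = y.
Proof.
exists (\row_j ((-1) ^+ h.2 (h.1^-1%g j) * y 0 (h.1^-1%g j))).
by apply/rowP => p; rewrite !mxE permK mulrA -signr_addb addbb mul1r.
Qed.

Lemma unfold_mul_act {d} (h : {perm 'I_n} * {ffun 'I_n -> bool}) (z : 'rV[R]_n)
    (X : 'M[R]_(n, d)) :
  (\row_p ((-1) ^+ h.2 p * z 0 (h.1 p))) *m act h X = z *m X.
Proof.
rewrite mul_act; congr (_ *m X); apply/matrixP => r j.
by rewrite !mxE permKV mulrA -signr_addb addbb mul1r ord1.
Qed.

(** For [d = 0] the space of relations is the whole space and meets every chamber, so the chamber
    count computes the order of the group. *)
Lemma card_block_group :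
  #|[set h : {perm 'I_n} * {ffun 'I_n -> bool} | block_group i h]| =
  (\prod_(x <- map size (@form_levels n k i n)) (1 + x))%N.
Proof.
have X0free : blocks_free (0 : 'M[R]_(n, 0)) by move=> C _; rewrite unitmxE det_mx00 unitr1.
have := met_chambers_kernel (leq0n n) X0free; rewrite subn0 => E.
rewrite -(@region_count_large _ n); last first.
  suff : forall p, size (map size (@form_levels n k i p)) = p by move=> ->.
  by elim=> //= p ->.
rewrite -E /met_chambers; apply: eq_card => h; rewrite !inE.
case: (boolP (block_group i h)) => //= Gh; apply/esym/asboolP.
have [y By] := base_chamber_nonempty; have [z zy] := unfold_chamber h y.
exists z; split; last by rewrite /chamber zy.
by apply/rowP => -[].
Qed.

(** The face is absent for [h] exactly when the chamber of [h] meets the relations, a generic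
    section of dimension [n - d]; the count is the order of the group minus the number of chambers
    met. *)
Lemma card_walk_faces {d} (X : 'M[R]_(n, d)) : (d <= n)%N -> (k < d)%N -> blocks_free X ->
  #|[set h | block_group i h & `[<walk_face i (act h X)>]]|%:R =
  2 * altsum (mon_poly (map size (@form_levels n k i n))) d :> R.
Proof.
move=> dn kd Xfree; set a := map _ _.
have sa : size a = n.
  suff : forall p, size (map size (@form_levels n k i p)) = p by exact.
  by elim=> //= p ->.
have := @region_count_altsum R a (n - d) (starts_with_one_levels i_incr (leqnn n)).
rewrite sa leq_subr subKn// => <- //.
have -> : \prod_(x <- a) (1 + x%:R) =
    #|[set h : {perm 'I_n} * {ffun 'I_n -> bool} | block_group i h]|%:R :> R.
  by rewrite card_block_group natr_prod; apply: eq_bigr => x _; rewrite natrD.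
rewrite -(met_chambers_kernel dn Xfree) /met_chambers; apply/eqP.
rewrite eq_sym subr_eq -natrD eqr_nat; apply/eqP.
(* The signed permutation is moved from the steps to the relation between them. *)
have faceP h : walk_face i (act h X) <->
    ~ exists z : 'rV[R]_n, z *m X = 0 /\ chamber i h z.
  rewrite (walk_face_support i_incr i_le_n (blocks_free_act h Xfree))// strict_supportP//;
    last exact: blocks_free_act.
  split=> ny [] => [z [zX Kz]|y By yX]; apply: ny.
    by exists (\row_p ((-1) ^+ h.2 p * z 0 (h.1 p))); rewrite ?unfold_mul_act.
  have [z zy] := unfold_chamber h y.
  by exists z; rewrite /chamber zy -(unfold_mul_act h) zy.
rewrite -cardsUI [X in (_ + X)%N](_ : _ = 0%N) ?addn0.
  apply: eq_card => h; rewrite !inE -andb_orr.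
  case: (boolP (block_group i h)) => //= Gh; apply/esym/orP.
  have [E|NE] := pselect (exists z : 'rV[R]_n, z *m X = 0 /\ chamber i h z).
    by right; apply/asboolP.
  by left; apply/asboolP/faceP.
apply/eqP; rewrite cards_eq0; apply/eqP/finset.setP => h; rewrite !inE.
apply/negbTE/negP => /andP[/andP[_ /asboolP/faceP nz] /andP[_ /asboolP//]].
Qed.

End face_count.

(** * Probabilities *)

Lemma free_unitmx {F : fieldType} {d : nat} (f : 'I_d -> 'rV[F]_d) :
  free [seq f a | a : 'I_d] = (\matrix_a f a \in unitmx).
Proof.
rewrite -[[seq f a | a : 'I_d]]/(val (mktuple f)); apply/freeP/idP => [H|U c].
  rewrite -row_free_unit; apply: inj_row_free => v vW; apply/rowP => a.
  rewrite [RHS]mxE; apply: (H (fun a => v 0 a)); rewrite -[RHS]vW mulmx_sum_row.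
  by apply: eq_bigr => b _; rewrite rowK -tnth_nth tnth_mktuple.
move=> c0 a; have : (\row_a c a) *m (\matrix_a f a) = 0.
  rewrite mulmx_sum_row -[RHS]c0; apply: eq_bigr => b _.
  by rewrite rowK mxE -tnth_nth tnth_mktuple.
move=> /(congr1 (mulmx^~ (invmx (\matrix_a f a)))); rewrite mulmxK// mul0mx => /rowP/(_ a).
by rewrite !mxE.
Qed.

Lemma measurable_degenerate {R : realType} {n d : nat} (t : 'I_d -> nat) :
  measurable [set X : 'M[R]_(n, d) | \matrix_(a < d) walk X (t a) \notin unitmx].
Proof.
rewrite (_ : [set X | _] = [set X : 'M[R]_(n, d) | \det (\matrix_(a < d) walk X (t a)) == 0]).
  apply: measurable_holds; apply: measurable_fun_eqr; last exact: measurable_cst.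
  rewrite /determinant; apply: measurable_sum => s.
  apply: measurable_fun_scale; apply: measurable_prod => a _.
  by under eq_fun do rewrite mxE; exact: measurable_walk.
by apply/seteqP; split=> X /=; rewrite unitmxE unitfE negbK.
Qed.

Section probability_counting.
Context {dT : measure_display} {T : measurableType dT} {R : realType}.

Lemma measurable_matrix {m n : nat} (f : T -> 'M[R]_(m, n)) :
  (forall a b, measurable_fun setT (fun w => f w a b)) -> measurable_fun setT f.
Proof.
move=> mf; apply: (measurability (@matrix_cylinder _ R m n)) => //.
move=> _ [B [a [b [C [mC ->]]]] <-].
by rewrite setTI; have := mf a b measurableT C mC; rewrite setTI.
Qed.

Variable P : probability T R.

Lemma negligible_exists {J : finType} (F : J -> set T) :
  (forall j, P.-negligible (F j)) -> P.-negligible [set w | exists j, F j w].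
Proof.
move=> NF; suff H (s : seq J) : P.-negligible [set w | exists2 j, j \in s & F j w].
  by apply: negligibleS (H (enum J)) => w [j Fj]; exists j; rewrite ?mem_enum.
elim: s => [|j s IHs].
  by apply: (negligibleS _ (negligible_set0 P)) => w [].
apply: (negligibleS _ (negligibleU (NF j) IHs)) => w [l].
by rewrite inE => /orP[/eqP->|ls] Fl; [left|right; exists l].
Qed.

(** The left side is the expectation of the number of events that occur, an almost surely constant
    variable. *)
Lemma sum_probability {H : finType} (G : {pred H}) (E : H -> set T) (N : nat) (bad : set T) :
  (forall h, measurable (E h)) -> P.-negligible bad ->
  (forall w, ~ bad w -> #|[set h | G h & `[<E h w>]]%SET| = N) ->
  (\sum_(h | G h) P (E h))%E = N%:R%:E.
Proof.
move=> mE Nbad cE.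
have mI h : measurable_fun setT (fun w => (\1_(E h) w)%:E : \bar R).
  by apply/measurable_EFinP; exact: measurable_indic.
transitivity (\int[P]_w (\sum_(h <- [seq h <- enum H | G h]) (\1_(E h) w)%:E))%E.
  rewrite ge0_integral_sum//.
  rewrite big_filter big_enum_cond; apply: eq_bigr => h _.
  by rewrite integral_indic// setIT.
rewrite (@ae_eq_integral _ _ _ P setT (cst N%:R%:E))//.
- by rewrite integral_cst// -[RHS]mule1; congr (_ * _)%E; exact: probability_setT.
- exact: emeasurable_sum.
apply: negligibleS Nbad => w /= /not_implyP[_ neq]; apply: contrapT => /cE cEw.
apply: neq; rewrite sumEFin -cEw; congr (_%:E).
rewrite -sum1_card natr_sum big_filter big_enum_cond big_mkcond [RHS]big_mkcond.
apply: eq_bigr => h _; rewrite inE; case: (G h) => //=.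
rewrite indicE; case: asboolP => Ew; first by rewrite mem_set.
by rewrite memNset.
Qed.

End probability_counting.

Section random_walk_faces.
Context {dT : measure_display} {T : measurableType dT} {R : realType}.
Context {P : probability T R} {n d : nat}.
Variable xi : 'I_n -> {RV P >-> 'rV[R]_d}.

Definition steps (w : T) : 'M[R]_(n, d) := \matrix_(j < n) xi j w.

Lemma partial_sumE p w : partial_sum xi p w = walk (steps w) p.
Proof. by apply: eq_bigr => j _; rewrite rowK. Qed.

Lemma act_steps h w :
  act h (steps w) = \matrix_(j < n) ((-1) ^+ h.2 j *: xi (h.1 j) w).
Proof. by apply/row_matrixP => j; rewrite !rowK. Qed.

Lemma measurable_steps : measurable_fun setT steps.
Proof.
apply: measurable_matrix => a b.
rewrite (_ : (fun w => _) = (fun w => (fun M : 'rV[R]_d => M 0 b) (xi a w))).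
  by apply: (measurableT_comp (measurable_entry 0 b)); exact: measurable_funPT.
by apply/funext => w; rewrite mxE.
Qed.

Lemma measurable_act_steps h : measurable_fun setT (fun w => act h (steps w)).
Proof.
apply: measurable_matrix => a b; rewrite (_ : (fun w => _) =
  (fun w => (-1) ^+ h.2 a * (fun M : 'M[R]_(n, d) => M (h.1 a) b) (steps w))).
  apply: measurable_fun_scale; apply: (measurableT_comp (measurable_entry _ b)).
  exact: measurable_steps.
by apply/funext => w; rewrite !mxE.
Qed.

Hypothesis pmEx : signed_exchangeable xi.

Lemma act_steps_law h (B : set 'M[R]_(n, d)) : measurable B ->
  P [set w | B (act h (steps w))] = P [set w | B (steps w)].
Proof.
move=> mB; have := pmEx h.1 h.2 mB; rewrite /steps => ->; congr (P _).
by apply/seteqP; split=> w /=; rewrite act_steps.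
Qed.

Hypothesis GP : general_position xi.

(** Exchangeability carries (GP) to the walk with steps rearranged by [h]; finitely many pairs
    [(h, t)] then give one null set. *)
Lemma degenerate_negligible h (t : {ffun 'I_d -> 'I_n.+1}) : (forall a, (0 < t a)%N) ->
  (forall a b : 'I_d, (a < b)%N -> (t a < t b)%N) ->
  P.-negligible [set w | \matrix_(a < d) walk (act h (steps w)) (t a) \notin unitmx].
Proof.
move=> t0 tlt; have mB := @measurable_degenerate R n d (fun a => t a).
apply/negligibleP.
  by have := measurable_act_steps h measurableT mB; rewrite setTI.
transitivity (P [set w | ~~ free [seq partial_sum xi (t a) w | a : 'I_d]]).
  apply: (etrans (act_steps_law h mB)); congr (P _).
  have E w : \matrix_(a < d) partial_sum xi (t a) w = \matrix_(a < d) walk (steps w) (t a).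
    by apply/row_matrixP => a; rewrite !rowK partial_sumE.
  by apply/seteqP; split=> w /=; rewrite free_unitmx E.
by apply: GP => [a|//]; rewrite t0 -ltnS ltn_ord.
Qed.

Definition degenerate_law (w : T) := exists h (t : {ffun 'I_d -> 'I_n.+1}),
  [/\ forall a, (0 < t a)%N, forall a b : 'I_d, (a < b)%N -> (t a < t b)%N
    & \matrix_(a < d) walk (act h (steps w)) (t a) \notin unitmx].

Lemma degenerate_law_negligible : P.-negligible [set w | degenerate_law w].
Proof.
apply: (@negligible_exists _ _ _ P _ (fun h => [set w | exists t : {ffun 'I_d -> 'I_n.+1}, _])) => h.
apply: (@negligible_exists _ _ _ P _ (fun t => [set w | _])) => t.
have [[t0 tlt]|nt] := pselect ((forall a, (0 < t a)%N) /\
    (forall a b : 'I_d, (a < b)%N -> (t a < t b)%N)).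
  by apply: negligibleS (degenerate_negligible h t0 tlt) => w [].
by apply: negligibleS (negligible_set0 P) => w [t0 tlt _]; apply: nt.
Qed.

Lemma blocks_free_steps w : ~ degenerate_law w -> blocks_free (steps w).
Proof.
move=> nd; apply: partial_sums_blocks => h t t0 tlt; apply/negPn/negP => U.
by apply: nd; exists h, t.
Qed.

End random_walk_faces.

Theorem theorem1p6 (R : realType) (dT : measure_display)
    (T : measurableType dT) (P : probability T R) (n d : nat)
    (d_ge1 : (1 <= d)%N) (d_le_n : (d <= n)%N)
    (xi : 'I_n -> {RV P >-> 'rV[R]_d})
    (pmEx : signed_exchangeable xi) (GP : general_position xi)
    (k : nat) (k_le : (k <= d - 1)%N) (i : 'I_k.+1 -> nat)
    (i_incr : forall a b : 'I_k.+1, (a < b)%N -> (i a < i b)%N)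
    (i_le_n : forall a : 'I_k.+1, (i a <= n)%N) :
  P [set w | faces k (walk_hull xi w)
               (convex_hull [set partial_sum xi (i a) w | a in [set: 'I_k.+1]])]
  = ((2 * \sum_(0 <= m < d)
            face_coef n i (d%:Z - k%:Z - 1 - 2 * m%:Z))
     / (2 ^+ (i ord0 + n - i ord_max)
        * (i ord0)`!%:R * (\prod_(l < k) (gap i l)`!%:R)
        * (n - i ord_max)`!%:R))%:E.
Proof.
have kd : (k < d)%N by lia.
have -> : [set w | faces k (walk_hull xi w)
      (convex_hull [set partial_sum xi (i a) w | a in [set: 'I_k.+1]])] =
    [set w | walk_face i (steps xi w)].
  apply/funext => w /=; rewrite /walk_face /walk_hull;
  congr (faces k (convex_hull _) (convex_hull _)).
    by apply/seteqP; split=> _ [p pn <-]; exists p => //; rewrite partial_sumE.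
  by apply/seteqP; split=> _ [a _ <-]; exists a => //; rewrite /walk_vertices partial_sumE.
have mface : measurable [set X : 'M[R]_(n, d) | walk_face i X] by exact: measurable_walk_face.
pose Gr : {pred {perm 'I_n} * {ffun 'I_n -> bool}} := block_group i.
have mE h : measurable [set w | walk_face i (act h (steps xi w))].
  by have := measurable_act_steps xi h measurableT mface; rewrite setTI.
set N := altsum (mon_poly (map size (@form_levels n k i n))) d : R.
set p := P _.
have pfin : p \is a fin_num.
  apply: fin_num_measure.
  by have := measurable_steps xi measurableT mface; rewrite setTI.
(* [2 * N] is an integer because it counts faces at any nondegenerate sample point; one exists since
   the total mass is 1. *)
have [m mN] : exists m : nat, m%:R = 2 * N.
  have [w nd] : exists w, ~ degenerate_law xi w.
    apply: contrapT => /forallNP Hd; have : P.-negligible [set: T].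
      apply: negligibleS (degenerate_law_negligible pmEx GP) => w _.
      by apply: contrapT; exact: Hd.
    move=> /(negligibleP _ measurableT) PT0.
    have PT1 : P setT = 1%E by exact: probability_setT.
    by have /eqP := etrans (esym PT1) PT0; rewrite onee_eq0.
  exists #|[set h | block_group i h & `[<walk_face i (act h (steps xi w))>]]%SET|.
  exact/card_walk_faces/blocks_free_steps.
have sumE : (\sum_(h | Gr h) P [set w | walk_face i (act h (steps xi w))])%E = m%:R%:E.
  apply: (sum_probability mE (degenerate_law_negligible pmEx GP)) => w nd.
  apply/eqP; rewrite -(@eqr_nat R) mN; apply/eqP.
  exact/card_walk_faces/blocks_free_steps.
have cG : #|Gr|%:R = \prod_(x <- map size (@form_levels n k i n)) (1 + x%:R) :> R.
  rewrite -[#|Gr|](cardsE Gr) card_block_group// natr_prod.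
  by apply: eq_bigr => x _; rewrite natrD.
(* By exchangeability every summand equals [p], so the order of the group times [p] is [2 * N]. *)
have : (\sum_(h | Gr h) (fine p)%:E)%E = m%:R%:E.
  by rewrite -sumE; apply: eq_bigr => h _; rewrite fineK// act_steps_law.
rewrite sumEFin => -[]; rewrite -[LHS]/(\sum_(h in Gr) fine p) sumr_const mN => E.
rewrite -[p]fineK//; congr (_%:E).
rewrite -count_one_add// -altsum_face_coef// -/N -E -cG -[fine p *+ _]mulr_natr.
rewrite mulfK// pnatr_eq0 -lt0n.
(* The identity lies in the group, so division by its order is legitimate. *)
apply/card_gt0P; exists (1%g, [ffun=> false]); apply/forallP => j.
by rewrite /= perm1 eqxx ffunE.
Qed.
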